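(* Let $g:\mathbb{R}\to\mathbb{C}$ be continuous with $|g(x)|\le A\exp(B|x|^{\rho})$ for all $x\in\mathbb{R}$, for some constants $A,B$ and some $\rho<2$. Let $H$ be the classical solution of the heat equation with boundary condition $g$. Let $\eta,\omega,\omega'\in{}^{*}\mathbb{N}\setminus\mathbb{N}$ with $\eta-\omega$ positive infinite, $\omega<\omega'^{1/2}$ and $\omega'<({}^{*}\log\eta)^{1/2}$. Let $g_\eta$ be the measurable extension of $g$ to $\overline{\mathcal R_\eta}$, let $g_{\eta,\omega}=g_\eta\,\chi_{[-\omega,\omega)}$, and let $f:\overline{\mathcal T_\eta}\times\overline{\mathcal R_\eta}\to{}^{*}\mathbb{C}$ be the unique measurable solution of the nonstandard heat equation $$\frac{\partial f}{\partial t}-\frac{\partial^2 f}{\partial x^2}=0\ \text{ on }\ \Big(\overline{\mathcal T_\eta}\setminus\big[\tfrac{\eta^2-1}{\eta},\eta\big)\Big)\times\overline{\mathcal R_\eta},\qquad f(0,x)=g_{\eta,\omega}(x)\ \ (x\in\overline{\mathcal R_\eta}).$$ Then for all finite $t\in\overline{\mathcal T_\eta}$ with ${}^{\circ}t>0$ and all finite $x\in\overline{\mathcal R_\eta}$, $${}^{\circ}\big((\check{F}_{\omega'}*f)(t,x)\big)=H({}^{\circ}t,{}^{\circ}x).$$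
   Context: Work in a (countably saturated) nonstandard universe; ${}^{\circ}$ denotes standard part. For infinite $\eta\in{}^{*}\mathbb{N}\setminus\mathbb{N}$ let $\overline{\mathcal R_\eta}=\{x\in{}^{*}\mathbb{R}:-\eta\le x<\eta\}$ and $\overline{\mathcal T_\eta}=\{t\in{}^{*}\mathbb{R}:0\le t<\eta\}$, divided into cells $[\frac{j}{\eta},\frac{j+1}{\eta})$ ($j\in{}^{*}\mathbb{Z}$; $-\eta^2\le j\le\eta^2-1$, resp. $0\le j\le\eta^2-1$). A function on $\overline{\mathcal R_\eta}$ (or on $\overline{\mathcal T_\eta}\times\overline{\mathcal R_\eta}$, or $\overline{\mathcal R_\eta}^2$) is measurable if it is internal and constant on each cell (product of cells). Each cell of $\overline{\mathcal R_\eta}$ has $\lambda_\eta$-measure $1/\eta$, so for measurable $u$, $\int_{\overline{\mathcal R_\eta}}u\,d\lambda_\eta=\frac1\eta{}^{*}\sum_{j=-\eta^2}^{\eta^2-1}u(\frac j\eta)$. $[\cdot]$ is the (transferred) integer part. The measurable extension of $g:\mathbb{R}\to\mathbb{C}$ is $g_\eta(x)={}^{*}g([\eta x]/\eta)$. $\chi_{[-\omega,\omega)}$ is the indicator function of $[-\omega,\omega)$. Discrete derivatives of measurable $f$: $\frac{\partial f}{\partial t}(\frac j\eta,x)=\eta(f(\frac{j+1}\eta,x)-f(\frac j\eta,x))$ for $0\le j\le\eta^2-2$, and $\frac{\partial f}{\partial t}(\frac{\eta^2-1}{\eta},x)=0$; $\frac{\partial f}{\partial x}(t,\frac j\eta)=\eta(f(t,\frac{j+1}\eta)-f(t,\frac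 j\eta))$ for $-\eta^2\le j\le\eta^2-2$, and $\frac{\partial f}{\partial x}(t,\frac{\eta^2-1}\eta)=0$ (extended to be constant on cells); $\frac{\partial^2 f}{\partial x^2}$ is the iterate. Given measurable boundary data there is a unique measurable solution of the nonstandard heat equation. $\exp_\eta(\pm\pi ixy)={}^{*}\exp(\pm\pi i\frac{[\eta x]}{\eta}\frac{[\eta y]}{\eta})$. Inverse transform in space: $\check{f}(t,y)=\int_{\overline{\mathcal R_\eta}}f(t,x)\exp_\eta(\pi ixy)\,d\lambda_\eta(x)$. Convolution: for measurable $u,v:\overline{\mathcal T_\eta}\times\overline{\mathcal R_\eta}\to{}^{*}\mathbb{C}$, $(u*v)(t,x)=\frac1\eta{}^{*}\sum_{k=-\eta^2}^{\eta^2-1}u\big(t,\frac{[\eta x]-k}{\eta}\big)v\big(t,\frac k\eta\big)$, where spatial arguments of $u$ are taken modulo $2\eta$ in $[-\eta,\eta)$. $F_{\omega'}:\overline{\mathcal T_\eta}\times\overline{\mathcal R_\eta}\to{}^{*}\mathbb{R}$ is the measurable function with $F_{\omega'}(t,\frac j\eta)=\frac12$ if $-\omega'\eta\le j\le\omega'\eta$ and $0$ otherwise. Classical solution: $H(0,x)=g(x)$ and $H(t,x)=\frac{1}{\sqrt{4\pi t}}\int_{\mathbb{R}}\exp\big(\frac{-(x-y)^2}{4t}\big)g(y)\,dy$ for $t>0$. *)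

(* Defs.v *)
From HB Require Import structures.
From mathcomp Require Import all_boot all_order all_algebra complex.
From mathcomp Require Import all_classical all_reals all_analysis.

Set Implicit Arguments.
Unset Strict Implicit.
Unset Printing Implicit Defensive.

Import Order.TTheory GRing.Theory Num.Theory numFieldNormedType.Exports.
Local Open Scope classical_set_scope.
Local Open Scope complex_scope.
Local Open Scope ring_scope.

(* A countably saturated nonstandard universe, given by its star map on sets
   ([star]), elements ([std]), functions ([smap]) and predicates ([sholds]).
   The elements of [star X] are the internal elements of *X; in particular an
   internal subset of *X is an element of [star (set X)] and an internal
   function *X -> *Y is an element of [star (X -> Y)].  The [sholds_*] laws are
   the inductive clauses of the transfer principle: they commute the star with
   substitution, equality, connectives and quantification over any standard
   set.  All ultrapowers modulo countably incomplete ultrafilters are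
   instances. *)
Record nonstandard_universe := NonstandardUniverse {
  star : Type -> Type ;
  std : forall X : Type, X -> star X ;
  smap : forall X Y : Type, (X -> Y) -> star X -> star Y ;
  spair : forall X Y : Type, star X -> star Y -> star (X * Y) ;
  sholds : forall X : Type, (X -> Prop) -> star X -> Prop ;
  smap_id : forall (X : Type) (a : star X), smap (fun x => x) a = a ;
  smap_comp : forall (X Y Z : Type) (u : X -> Y) (v : Y -> Z) (a : star X),
    smap (fun x => v (u x)) a = smap v (smap u a) ;
  smap_std : forall (X Y : Type) (u : X -> Y) (x : X),
    smap u (std x) = std (u x) ;
  smap_fst : forall (X Y : Type) (a : star X) (b : star Y),
    smap fst (spair a b) = a ;
  smap_snd : forall (X Y : Type) (a : star X) (b : star Y),
    smap snd (spair a b) = b ;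
  spair_eta : forall (X Y : Type) (c : star (X * Y)),
    spair (smap fst c) (smap snd c) = c ;
  sholds_std : forall (X : Type) (P : X -> Prop) (x : X),
    sholds P (std x) <-> P x ;
  sholds_map : forall (X Y : Type) (u : X -> Y) (P : Y -> Prop) (a : star X),
    sholds (fun x => P (u x)) a <-> sholds P (smap u a) ;
  sholds_eq : forall (X : Type) (a b : star X),
    sholds (fun p => p.1 = p.2) (spair a b) <-> a = b ;
  sholds_not : forall (X : Type) (P : X -> Prop) (a : star X),
    sholds (fun x => ~ P x) a <-> ~ sholds P a ;
  sholds_and : forall (X : Type) (P Q : X -> Prop) (a : star X),
    sholds (fun x => P x /\ Q x) a <-> sholds P a /\ sholds Q a ;
  sholds_ex : forall (X Y : Type) (P : X * Y -> Prop) (a : star X),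
    sholds (fun x => exists y, P (x, y)) a <->
    exists b, sholds P (spair a b) ;
  countable_saturation : forall (X : Type) (S : nat -> star (set X)),
    (forall n, exists a : star X, forall k, (k <= n)%N ->
       sholds (fun p => p.2 p.1) (spair a (S k))) ->
    exists a : star X, forall k, sholds (fun p => p.2 p.1) (spair a (S k))
}.

Arguments std {_ _} _.
Arguments smap {_ _ _} _ _.
Arguments spair {_ _ _} _ _.
Arguments sholds {_ _} _ _.

Section Star.
Variable N : nonstandard_universe.

Definition smap2 (X Y Z : Type) (u : X -> Y -> Z) (a : star N X) (b : star N Y)
  : star N Z := smap (fun p => u p.1 p.2) (spair a b).

Definition sholds2 (X Y : Type) (r : X -> Y -> Prop)
  (a : star N X) (b : star N Y) : Prop :=
  sholds (fun p => r p.1 p.2) (spair a b).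

Definition smem (X : Type) (a : star N X) (A : star N (set X)) : Prop :=
  sholds2 (fun (x : X) (B : set X) => B x) a A.

Definition sapp (X Y : Type) (f : star N (X -> Y)) (a : star N X) : star N Y :=
  smap2 (fun (h : X -> Y) x => h x) f a.

Definition sapp2 (X Y Z : Type) (f : star N (X -> Y -> Z))
  (a : star N X) (b : star N Y) : star N Z := sapp (sapp f a) b.

Definition infinite_snat (a : star N nat) : Prop := forall n : nat, a <> std n.

Definition snat (R : realType) (a : star N nat) : star N R :=
  smap (fun n : nat => n%:R) a.

Definition slt (R : realType) (a b : star N R) : Prop :=
  sholds2 (fun x y : R => x < y) a b.

Definition ssub (V : zmodType) (a b : star N V) : star N V :=
  smap2 (fun x y : V => x - y) a b.

Definition positive_infinite (R : realType) (a : star N R) : Prop :=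
  forall r : R, slt (std r) a.

(* On V = R[i], [0 < e] forces e to be real. *)
Definition is_std_part (V : numFieldType) (a : star N V) (x : V) : Prop :=
  forall e : V, 0 < e -> sholds (fun y => `|y - x| < e) a.

Definition star_finite (V : numFieldType) (a : star N V) : Prop :=
  exists r : V, sholds (fun y => `|y| <= r) a.

(* The standard part; only meaningful on finite a (junk value 0 otherwise). *)
Definition st (V : numFieldType) (a : star N V) : V :=
  xget 0 [set x | is_std_part a x].

End Star.

(* The objects of the discrete calculus at a standard resolution n.  Their
   nonstandard counterparts are the values at eta of the starred families. *)
Section Discrete.
Variable R : realType.
Local Notation C := R[i].

Definition grid_space (n : nat) : set R := [set x | - n%:R <= x < n%:R].

Definition grid_time (n : nat) : set R := [set t | 0 <= t < n%:R].

Definition heat_time (n : nat) : set R :=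
  grid_time n `\` [set t | (n%:R ^+ 2 - 1) / n%:R <= t < n%:R].

Definition node (n : nat) (j : int) : R := j%:~R / n%:R.

Definition cell (n : nat) (j : int) : set R :=
  [set x | node n j <= x < node n (j + 1)].

Definition idx (n : nat) (x : R) : int := Num.floor (n%:R * x).

Definition meas_ext (n : nat) (h : R -> C) : R -> C :=
  fun x => h (node n (idx n x)).

Definition truncate (m : nat) (h : R -> C) : R -> C :=
  fun x => if - m%:R <= x < m%:R then h x else 0.

(* The sum of u j over - n ^ 2 <= j <= n ^ 2 - 1. *)
Definition grid_sum (n : nat) (u : int -> C) : C :=
  \sum_(i < 2 * n ^ 2) u (i%:Z - n%:Z ^+ 2).

Definition space_int (n : nat) (u : R -> C) : C :=
  n%:R^-1 * grid_sum n (fun j => u (node n j)).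

Definition diff_t (n : nat) (f : R -> R -> C) : R -> R -> C := fun t x =>
  let j := idx n t in
  if j <= n%:Z ^+ 2 - 2 then n%:R * (f (node n (j + 1)) x - f (node n j) x)
  else 0.

Definition diff_x (n : nat) (f : R -> R -> C) : R -> R -> C := fun t x =>
  let j := idx n x in
  if j <= n%:Z ^+ 2 - 2 then n%:R * (f t (node n (j + 1)) - f t (node n j))
  else 0.

Definition diff_xx (n : nat) (f : R -> R -> C) : R -> R -> C :=
  diff_x n (diff_x n f).

Definition expi (a : R) : C := cos a +i* sin a.

Definition grid_expi (n : nat) (x y : R) : C :=
  expi (pi * node n (idx n x) * node n (idx n y)).

Definition inv_transform (n : nat) (f : R -> R -> C) : R -> R -> C :=
  fun t y => space_int n (fun x => f t x * grid_expi n x y).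

(* Representative of y modulo 2n in [-n, n). *)
Definition grid_wrap (n : nat) (y : R) : R :=
  y - 2 * n%:R * (Num.floor ((y + n%:R) / (2 * n%:R)))%:~R.

Definition grid_conv (n : nat) (u v : R -> R -> C) : R -> R -> C := fun t x =>
  n%:R^-1 * grid_sum n (fun k =>
    u t (grid_wrap n (node n (idx n x - k))) * v t (node n k)).

Definition cutoff (n m : nat) : R -> R -> C := fun t x =>
  let j := idx n x in
  if - (m%:Z * n%:Z) <= j <= m%:Z * n%:Z then 2^-1 else 0.

Definition cintegral (h : R -> C) : C :=
  (\int[lebesgue_measure]_(y in [set: R]) complex.Re (h y)) +i*
  (\int[lebesgue_measure]_(y in [set: R]) complex.Im (h y)).

(* Only used at t >= 0. *)
Definition classical_heat (g : R -> C) (t x : R) : C :=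
  if t == 0 then g x else
  ((Num.sqrt (4 * pi * t))^-1)%:C *
  cintegral (fun y => (expR (- (x - y) ^+ 2 / (4 * t)))%:C * g y).

End Discrete.

Section Nonstandard.
Variables (N : nonstandard_universe) (R : realType) (eta : star N nat).
Local Notation C := R[i].

Definition sspace : star N (set R) := smap (@grid_space R) eta.
Definition stime : star N (set R) := smap (@grid_time R) eta.
Definition sheat_time : star N (set R) := smap (@heat_time R) eta.
Definition scell (j : star N int) : star N (set R) := smap2 (@cell R) eta j.

(* f is internal by typing; its values off stime x sspace are irrelevant. *)
Definition smeasurable (f : star N (R -> R -> C)) : Prop :=
  forall (i j : star N int) (t t' x x' : star N R),
    smem t stime -> smem t' stime -> smem x sspace -> smem x' sspace ->
    smem t (scell i) -> smem t' (scell i) ->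
    smem x (scell j) -> smem x' (scell j) ->
    sapp2 f t x = sapp2 f t' x'.

Definition smeas_ext (g : R -> C) : star N (R -> C) :=
  smap2 (@meas_ext R) eta (std g).

Definition struncate (omega : star N nat) (h : star N (R -> C)) :
  star N (R -> C) := smap2 (@truncate R) omega h.

Definition sdiff_t (f : star N (R -> R -> C)) : star N (R -> R -> C) :=
  smap2 (@diff_t R) eta f.

Definition sdiff_xx (f : star N (R -> R -> C)) : star N (R -> R -> C) :=
  smap2 (@diff_xx R) eta f.

Definition sinv_transform (f : star N (R -> R -> C)) : star N (R -> R -> C) :=
  smap2 (@inv_transform R) eta f.

Definition sconv (u v : star N (R -> R -> C)) : star N (R -> R -> C) :=
  smap2 (fun n p => grid_conv n p.1 p.2) eta (spair u v).

Definition scutoff (omega' : star N nat) : star N (R -> R -> C) :=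
  smap2 (@cutoff R) eta omega'.

Definition heat_solution (h : star N (R -> C)) (f : star N (R -> R -> C)) :
  Prop :=
  [/\ smeasurable f,
      forall t x : star N R, smem t sheat_time -> smem x sspace ->
        ssub (sapp2 (sdiff_t f) t x) (sapp2 (sdiff_xx f) t x) = std 0 &
      forall x : star N R, smem x sspace -> sapp2 f (std 0) x = sapp h x].

End Nonstandard.

(* Main.v *)
(* One time step of the scheme multiplies the Fourier mode exp(i pi y x), y = l/n,
   by 1 + n (exp(i pi y/n) - 1)^2.  High modes blow up, but the filter keeps only
   |y| <= M (M = omega'), where n t steps multiply by
   exp(- pi^2 y^2 t) + O(M^4/n).  So the filtered solution is the initial datum
   convolved with a kernel that is close to
   S(z) = (2n)^-1 sum_{|y| <= M} cos(pi y z) exp(- pi^2 t y^2).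
   No Fourier integral is needed: S' + z/(2t) S is, up to O(M^3/n), the telescoping
   sum of the differences of sin(pi y z) exp(- pi^2 t y^2), hence tiny, so
   S(z) = S(0) exp(- z^2/4t) + O(M exp(- pi^2 t M^2)) + O(M^4/n).  Since
   1/n <= exp(- M^2), these errors beat the size exp(m^2) <= exp(M) of the datum
   cut off at m = omega.  What is left are Riemann sums of Gaussian-dominated
   functions, handled by dominated convergence.  The nonstandard statement follows
   by transfer: if it failed, every standard k would give a finite-resolution
   counterexample, and these would contradict the limit along a sequence. *)

(* The scheme is unstable, so [f] has no useful size estimate and is handled only through exact
   Fourier identities. A discrete transform on [2 n ^ 2] points diagonalizes a periodic scheme,
   whereas the one at hand has artificial ends. Periodicity is regained from the support: the datum
   lives on [[-m, m)], a step moves its left end by two cells and its right end not at all, and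
   [2 n t + m n < n ^ 2] because [n - m] is large while [t] stays bounded. All boundary terms are
   then zero, and this is where the infinite gap between [eta] and [omega] enters. The filter has
   height one half because transforming back and forth with [exp (+- pi i x y)] on [[-n, n)]
   multiplies by 2. The kernel is estimated in absolute terms, uniformly over the relevant nodes,
   not relative to the Gaussian. The error is thus multiplied by the largest value of the truncated
   datum, which forces [m ^ 2 <= M] and [M ^ 2 <= ln n]. Every polynomial factor in [M] is absorbed
   by a power of [exp M], and [exp (- c M ^ 2)] outweighs them all. *)
Require Import Defs.
From HB Require Import structures.
From mathcomp Require Import all_boot all_order all_algebra complex.
From mathcomp Require Import all_classical all_reals all_analysis.
From mathcomp Require Import measurable_realfun ring lra zify.

Import Order.TTheory GRing.Theory Num.Theory numFieldNormedType.Exports.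
Import Normc.
Local Open Scope classical_set_scope.
Local Open Scope complex_scope.
Local Open Scope ring_scope.

(** * Transfer *)

Section Transfer.
Set Implicit Arguments.
Unset Strict Implicit.
Context {N : nonstandard_universe}.

Lemma spair_smap (X Y Z : Type) (p : X -> Y) (q : X -> Z) (c : star N X) :
  spair (smap p c) (smap q c) = smap (fun w => (p w, q w)) c.
Proof. by rewrite -[RHS]spair_eta -!smap_comp. Qed.

(** By extensionality such a predicate equals [fun x => x = x], which holds at every point by the
    law [sholds_eq]. Monotonicity and inhabitation below follow from this. *)
Lemma sholds_all_std {X : Type} {P : X -> Prop} (a : star N X) :
  (forall x, P x) -> sholds P a.
Proof.
move=> PT; have /(sholds_eq a) : a = a by [].
rewrite -{1 2}(smap_id a) spair_smap -sholds_map.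
by congr sholds; apply/funext => x; apply/propext; split.
Qed.

Lemma sholds_imp (X : Type) (P Q : X -> Prop) (a : star N X) :
  sholds (fun x => P x -> Q x) a <-> (sholds P a -> sholds Q a).
Proof.
have -> : (fun x => P x -> Q x) = (fun x => ~ (P x /\ ~ Q x)).
  apply/funext => x; apply/propext; split; first by move=> PQ [/PQ].
  by move=> PQ Px; apply: contrapT => nQ; apply: PQ.
rewrite sholds_not sholds_and sholds_not; split=> [PQ Pa|PQ [/PQ]//].
by apply: contrapT => nQ; apply: PQ.
Qed.

Lemma sub_sholds {X : Type} {P Q : X -> Prop} (a : star N X) :
  (forall x, P x -> Q x) -> sholds P a -> sholds Q a.
Proof. by move=> PQ; apply/sholds_imp/sholds_all_std. Qed.

Lemma sholds_inhabited {X : Type} {P : X -> Prop} {a : star N X} :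
  sholds P a -> exists x, P x.
Proof.
move=> Pa; apply: contrapT => nP; have /sholds_not : sholds (fun x => ~ P x) a.
  by apply: sholds_all_std => x Px; apply: nP; exists x.
exact.
Qed.

Lemma sholds_conj {X : Type} {P Q : X -> Prop} {a : star N X} :
  sholds P a -> sholds Q a -> sholds (fun x => P x /\ Q x) a.
Proof. by move=> Pa Qa; apply/sholds_and. Qed.

(** Double negation of the existential law: a counterexample would be an internal witness [b]. *)
Lemma sholds_forall (X Y : Type) (P : X -> Y -> Prop) (a : star N X) :
  (forall b, sholds (fun w => P w.1 w.2) (spair a b)) ->
  sholds (fun x => forall y, P x y) a.
Proof.
move=> Pa; have : ~ sholds (fun x => exists y, ~ P x y) a.
  by move=> /(sholds_ex (fun w => ~ P w.1 w.2))[b /sholds_not]; apply.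
by move=> /sholds_not; apply: sub_sholds => x /forallNP nP y; apply: contrapT.
Qed.

Lemma smap_cst (X Y : Type) (y : Y) (a : star N X) :
  smap (fun=> y) a = std y.
Proof.
(* Over this pair the constant [y] and the second coordinate agree, since [z = y] holds at
   [std y]. *)
set d := spair a (std y).
have -> : a = smap fst d by rewrite smap_fst.
rewrite -smap_comp -[RHS](smap_snd a (std y)) -/d.
apply/esym/sholds_eq; rewrite spair_smap -sholds_map.
by rewrite (sholds_map snd (fun z => z = y)) smap_snd sholds_std.
Qed.

Lemma smap2_smap (X Y Z W : Type) (u : Y -> Z -> W) (p : X -> Y) (q : X -> Z)
    (c : star N X) :
  smap2 u (smap p c) (smap q c) = smap (fun w => u (p w) (q w)) c.
Proof. by rewrite /smap2 spair_smap -smap_comp. Qed.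

Lemma smem_smap (X Y : Type) (p : X -> Y) (q : X -> set Y) (c : star N X) :
  smem (smap p c) (smap q c) <-> sholds (fun w => q w (p w)) c.
Proof. by rewrite /smem /sholds2 spair_smap -sholds_map. Qed.

Lemma sapp_smap (X Y Z : Type) (h : X -> Y -> Z) (p : X -> Y) (c : star N X) :
  sapp (smap h c) (smap p c) = smap (fun w => h w (p w)) c.
Proof. exact: smap2_smap. Qed.

Lemma sapp2_smap (X Y Z W : Type) (h : X -> Y -> Z -> W) (p : X -> Y)
    (q : X -> Z) (c : star N X) :
  sapp2 (smap h c) (smap p c) (smap q c) = smap (fun w => h w (p w) (q w)) c.
Proof. by rewrite /sapp2 !sapp_smap. Qed.

Lemma smap_eq (X Y : Type) (p q : X -> Y) (c : star N X) :
  smap p c = smap q c <-> sholds (fun w => p w = q w) c.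
Proof. by rewrite -sholds_eq spair_smap -sholds_map. Qed.

(** [infinite_snat] only says that [a] differs from each standard number; excluding these one at a
    time gives the lower bounds. *)
Lemma infinite_snat_ge {a : star N nat} (k : nat) :
  infinite_snat a -> sholds (fun n => (k <= n)%N) a.
Proof.
move=> a_inf; elim: k => [|k IH]; first exact: sholds_all_std.
have : sholds (fun n => n <> k) a.
  apply/sholds_not => ak; apply: (a_inf k).
  by rewrite -[LHS]smap_id -(smap_cst _ a) smap_eq.
move=> /(sholds_conj IH); apply: sub_sholds => n [kn /eqP nk].
by rewrite ltn_neqAle eq_sym nk.
Qed.

Lemma is_std_part_unique (V : numFieldType) (a : star N V) (x y : V) :
  is_std_part a x -> is_std_part a y -> x = y.
Proof.
move=> ax ay; apply/eqP; apply: contrapT => /negP; rewrite -subr_eq0 -normr_gt0.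
move=> xy; have e0 : 0 < `|x - y| / 2 by rewrite divr_gt0.
have /sholds_inhabited[z [zx zy]] := sholds_conj (ax _ e0) (ay _ e0).
have := ler_distD z x y; rewrite lt_geF// (distrC x z).
by rewrite [ltRHS](splitr `|x - y|) ltrD.
Qed.

Lemma st_eq (V : numFieldType) (a : star N V) (x : V) :
  is_std_part a x -> st a = x.
Proof.
by move=> ax; apply: xget_unique => // y /is_std_part_unique; apply.
Qed.

(** Completeness of the reals: the standard part is the supremum of the standard numbers below
    [a]. *)
Lemma st_is_std_part (R : realType) (a : star N R) :
  star_finite a -> is_std_part a (st a).
Proof.
move=> [r ar]; suff [x ax] : exists x, is_std_part a x by rewrite (st_eq ax).
pose S := [set s | sholds (fun y => s < y) a].
have S_ub : ubound S r.
  move=> s /= sa; have /sholds_inhabited[y [sy yr]] := sholds_conj sa ar.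
  by rewrite (le_trans (ltW sy))// (le_trans (ler_norm _)).
have S_sup : has_sup S.
  split; last by exists r.
  exists (- r - 1); apply: sub_sholds ar => y.
  by rewrite ler_norml => /andP[+ _]; apply: lt_le_trans; rewrite ltrBlDr ltrDl.
exists (sup S) => e e0.
have [s Ss sS] := sup_adherent e0 S_sup.
(* [sup S + e / 2] is outside [S], so [a] is at most that number; halving [e] makes the bound
   strict. *)
have : sholds (fun y => y < sup S + e) a.
  have : ~ S (sup S + e / 2).
    move=> /(ub_le_sup S_sup.2); apply/negP.
    by rewrite -ltNge ltrDl divr_gt0.
  move=> /sholds_not; apply: sub_sholds => y /negP; rewrite -leNgt => /le_lt_trans.
  by apply; rewrite ltrD2l ltr_pdivrMr// ltr_pMr// ltr1n.
move=> /(sholds_conj Ss); apply: sub_sholds => y [sy ye].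
by rewrite ltr_distl ye (lt_trans sS).
Qed.

End Transfer.

(** * The scheme at a standard resolution *)

(** The standard property whose transfer is [heat_solution]. *)
Definition discrete_heat_solution {R : realType} (n : nat) (h : R -> R[i])
    (f : R -> R -> R[i]) : Prop :=
  [/\ forall (i j : int) (t t' x x' : R),
        grid_time n t -> grid_time n t' -> grid_space n x -> grid_space n x' ->
        cell n i t -> cell n i t' -> cell n j x -> cell n j x' -> f t x = f t' x',
      forall t x, heat_time n t -> grid_space n x ->
        diff_t n f t x - diff_xx n f t x = 0 &
      forall x, grid_space n x -> f 0 x = h x].

(** [heat_solution] quantifies from outside over elements of star sets. Each tuple of such elements
    is an internal witness, so [sholds_forall] turns the clauses into statements at the point
    [c]. *)
Lemma heat_solution_smap (N : nonstandard_universe) (R : realType) (W : Type)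
    (n : W -> nat) (h : W -> R -> R[i]) (f : W -> R -> R -> R[i])
    (c : star N W) :
  heat_solution (smap n c) (smap h c) (smap f c) ->
  sholds (fun w => discrete_heat_solution (n w) (h w) (f w)) c.
Proof.
move=> [f_meas f_heat f_init].
have P1 : sholds (fun w => forall y : int * int * R * R * R * R,
    grid_time (n w) y.1.1.1.2 -> grid_time (n w) y.1.1.2 ->
    grid_space (n w) y.1.2 -> grid_space (n w) y.2 ->
    cell (n w) y.1.1.1.1.1 y.1.1.1.2 -> cell (n w) y.1.1.1.1.1 y.1.1.2 ->
    cell (n w) y.1.1.1.1.2 y.1.2 -> cell (n w) y.1.1.1.1.2 y.2 ->
    f w y.1.1.1.2 y.1.2 = f w y.1.1.2 y.2) c.
  (* All bound variables are coordinates of the point [d], where premises and conclusion are read;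
     rewriting backwards recovers the form of [f_meas]. *)
  apply: sholds_forall => b; set d := spair c b.
  do 8!apply/sholds_imp => ?.
  rewrite -(@smap_eq _ _ _ (fun d => f d.1 _ _) (fun d => f d.1 _ _)).
  rewrite -(sapp2_smap (fun d => f d.1)) -(sapp2_smap (fun d => f d.1)).
  rewrite (smap_comp fst f) smap_fst.
  pose i : star N int := smap (fun d => d.2.1.1.1.1.1) d.
  pose j : star N int := smap (fun d => d.2.1.1.1.1.2) d.
  apply: (f_meas i j); rewrite /stime /sspace /scell /i /j;
    rewrite -[X in smap n X](smap_fst c b) -/d -smap_comp ?smap2_smap;
    by rewrite -?smap_comp smem_smap.
have P2 : sholds (fun w => forall y : R * R,
    heat_time (n w) y.1 -> grid_space (n w) y.2 ->
    diff_t (n w) (f w) y.1 y.2 - diff_xx (n w) (f w) y.1 y.2 = 0) c.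
  apply: sholds_forall => b; set d := spair c b.
  do 2!apply/sholds_imp => ?.
  rewrite -(@smap_eq _ _ _ (fun d => _ - _) (fun=> _)) smap_cst.
  rewrite -(smap2_smap (fun x y => x - y)).
  rewrite -(sapp2_smap (fun d => diff_t (n d.1) (f d.1))).
  rewrite -(sapp2_smap (fun d => diff_xx (n d.1) (f d.1))).
  rewrite -!(smap2_smap _ (fun d => n d.1) (fun d => f d.1)).
  rewrite (smap_comp fst n) (smap_comp fst f) smap_fst.
  apply: f_heat; rewrite /sheat_time /sspace;
    by rewrite -[X in smap n X](smap_fst c b) -/d -!smap_comp smem_smap.
have P3 : sholds (fun w => forall y : R, grid_space (n w) y ->
    f w 0 y = h w y) c.
  apply: sholds_forall => b; set d := spair c b.
  apply/sholds_imp => ?.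
  rewrite -(@smap_eq _ _ _ (fun d => f d.1 _ _) (fun d => h d.1 _)).
  rewrite -(sapp2_smap (fun d => f d.1)) -(sapp_smap (fun d => h d.1)).
  rewrite smap_cst (smap_comp fst h) (smap_comp fst f) smap_fst.
  apply: f_init; rewrite /sspace.
  by rewrite -[X in smap n X](smap_fst c b) -/d -!smap_comp smem_smap.
apply: sub_sholds (sholds_conj P1 (sholds_conj P2 P3)) => w [Q1 [Q2 Q3]]; split.
- by move=> i j t t' x x'; apply: (Q1 (i, j, t, t', x, x')).
- by move=> t x; apply: (Q2 (t, x)).
- exact: Q3.
Qed.

Section Grid.
Set Implicit Arguments.
Unset Strict Implicit.
Context {R : realType}.
Local Notation C := R[i].

Lemma expiD (a b : R) : expi (a + b) = expi a * expi b.
Proof. by rewrite /expi cosD sinD; simpc; rewrite [in X in _ +i* X]addrC. Qed.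

Lemma expi0 : expi 0 = 1 :> C.
Proof. by rewrite /expi cos0 sin0. Qed.

Lemma normc_expi (a : R) : normc (expi a) = 1.
Proof. by rewrite /= cos2Dsin2 sqrtr1. Qed.

Lemma expi_2pi_nat (k : nat) : expi (pi *+ 2 * k%:R) = 1 :> C.
Proof.
elim: k => [|k IH]; first by rewrite mulr0 expi0.
by rewrite -natr1 mulrDr expiD IH mul1r mulr1 /expi cos2pi sin2pi.
Qed.

Lemma expi_2pi_int (k : int) : expi (pi *+ 2 * k%:~R) = 1 :> C.
Proof.
case: k => k; first exact: expi_2pi_nat.
have := expi0; rewrite NegzE mulrNz mulrN -(subrr (pi *+ 2 * k.+1%:R)).
by rewrite expiD expi_2pi_nat mul1r.
Qed.

Lemma idx_node (n : nat) (j : int) : (0 < n)%N -> idx n (node R n j) = j.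
Proof.
move=> n0; rewrite /idx /node mulrCA divff ?mulr1 ?intrKfloor//.
by rewrite pnatr_eq0 -lt0n.
Qed.

Lemma node_space (n : nat) (k : int) : (0 < n)%N ->
  - n%:Z ^+ 2 <= k < n%:Z ^+ 2 -> grid_space n (node R n k).
Proof.
move=> n0 /andP[k1 k2]; rewrite /grid_space/= /node.
have n0' : 0 < n%:R :> R by rewrite ltr0n.
rewrite ler_pdivlMr// ltr_pdivrMr// mulNr -expr2.
have -> : n%:R ^+ 2 = (n%:Z ^+ 2)%:~R :> R by rewrite rmorphXn.
by rewrite -mulrNz ler_int ltr_int k1.
Qed.

Lemma eq_grid_sum (n : nat) (u v : int -> C) :
  (forall k, - n%:Z ^+ 2 <= k < n%:Z ^+ 2 -> u k = v k) ->
  grid_sum n u = grid_sum n v.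
Proof.
move=> uv; apply: eq_bigr => i _; apply: uv.
by have := ltn_ord i; move: (nat_of_ord i) => {}i; lia.
Qed.

Lemma grid_sumD (n : nat) (u v : int -> C) :
  grid_sum n (fun k => u k + v k) = grid_sum n u + grid_sum n v.
Proof. exact: big_split. Qed.

Lemma grid_sumZ (n : nat) (c : C) (u : int -> C) :
  grid_sum n (fun k => c * u k) = c * grid_sum n u.
Proof. by rewrite /grid_sum mulr_sumr. Qed.

Lemma exchange_grid_sum (n : nat) (u : int -> int -> C) :
  grid_sum n (fun k => grid_sum n (u k)) =
  grid_sum n (fun l => grid_sum n (u^~ l)).
Proof. exact: exchange_big. Qed.

(** The shift trades the first term of the sum for the one just past its end. *)
Lemma grid_sum_shift (n : nat) (v : int -> C) :
  v (n%:Z ^+ 2) = v (- n%:Z ^+ 2) ->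
  grid_sum n (fun k => v (k + 1)) = grid_sum n v.
Proof.
rewrite /grid_sum => vn; set N := (2 * n ^ 2)%N.
have N0 : v (N%:Z - n%:Z ^+ 2) = v (0%:Z - n%:Z ^+ 2).
  by rewrite sub0r -vn; congr v; rewrite /N; lia.
apply: (addrI (v (0%:Z - n%:Z ^+ 2))); rewrite -[in RHS]N0 [RHS]addrC.
rewrite -(big_ord_recr N (fun i => v (i%:Z - n%:Z ^+ 2)))/=.
rewrite (big_ord_recl N (fun i => v (Posz (nat_of_ord i) - n%:Z ^+ 2)))/=.
congr (_ + _); apply: eq_bigr => i _; congr v.
by rewrite /bump /=; lia.
Qed.

(** The scheme on all integers: with no ends to the grid, neither shifts nor the induction on steps
    need a case distinction. *)
Definition lattice_heat (n : nat) (b : int -> C) (i : nat) : int -> C :=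
  iter i (fun b k => b k + n%:R * (b (k + 2) - 2 * b (k + 1) + b k)) b.

Lemma lattice_heat_supp_right (n : nat) (b : int -> C) (c : int) :
  (forall k, c <= k -> b k = 0) ->
  forall i k, c <= k -> lattice_heat n b i k = 0.
Proof.
move=> bc; elim=> [|i IH] k ck; [exact: bc|rewrite /=].
by rewrite !IH ?(subr0, mulr0, addr0)//; lia.
Qed.

(** The second forward difference at [k] reads as far as [k + 2], so the left end of the support
    moves by two cells per step. *)
Lemma lattice_heat_supp_left (n : nat) (b : int -> C) (c : int) :
  (forall k, k < c -> b k = 0) ->
  forall i k, k < c - 2 * i%:Z -> lattice_heat n b i k = 0.
Proof.
move=> bc; elim=> [|i IH] k ck; [apply: bc; lia|rewrite /=].
by rewrite !IH ?(subr0, mulr0, addr0)//; lia.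
Qed.

Definition amplification (n : nat) (l : int) : C :=
  1 + n%:R * (expi (pi * node R n l / n%:R) - 1) ^+ 2.

(** The mode satisfies [e k = q * e (k + 1)], so shifting the summation index turns a step into
    multiplication by [1 + n * (q - 1) ^ 2]. The shifts have no boundary terms while the support
    avoids both ends of the grid; the last premise secures this on the left. *)
Lemma lattice_heat_dft (n : nat) (b : int -> C) (i : nat) (c : int) (l : int) :
  (0 < n)%N -> (forall k, n%:Z ^+ 2 - 2 < k -> b k = 0) ->
  (forall k, k < c -> b k = 0) -> 2 * i%:Z - c < n%:Z ^+ 2 - 1 ->
  grid_sum n (fun k => lattice_heat n b i k *
    expi (- (pi * node R n l * node R n k))) =
  amplification n l ^+ i *
  grid_sum n (fun k => b k * expi (- (pi * node R n l * node R n k))).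
Proof.
move=> n0 br bl; elim: i => [|i IH] ic; first by rewrite expr0 mul1r.
have n0' : n%:R != 0 :> R by rewrite pnatr_eq0 -lt0n.
rewrite exprS -mulrA -IH; last by lia.
set e := fun k => expi (- (pi * node R n l * node R n k)).
set q := expi (pi * node R n l / n%:R).
have eS k : e k = q * e (k + 1).
  by rewrite /e /q -expiD /node intrD; congr expi; field.
set v := lattice_heat n b i.
have vr k : n%:Z ^+ 2 - 2 < k -> v k = 0.
  move=> nk; apply: (@lattice_heat_supp_right _ _ (n%:Z ^+ 2 - 1)); last by lia.
  by move=> k' ?; apply: br; lia.
have vl k : k <= 1 - n%:Z ^+ 2 -> v k = 0.
  by move=> nk; apply: (@lattice_heat_supp_left n b c bl i); lia.
transitivity (grid_sum n (fun k => v k * e k + (n%:R * q ^+ 2 *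
    (v (k + 1 + 1) * e (k + 1 + 1)) + (- 2 * n%:R * q * (v (k + 1) * e (k + 1))
    + n%:R * (v k * e k))))).
  apply: eq_grid_sum => k _ /=; rewrite -/v -/(e k).
  have -> : k + 2 = k + 1 + 1 by rewrite -addrA.
  move: (eS k) (eS (k + 1)); move: (e k) (e (k + 1)) (e (k + 1 + 1)).
  by move=> x y z -> ->; ring.
rewrite 3!grid_sumD !grid_sumZ.
rewrite (@grid_sum_shift n (fun k => v (k + 1) * e (k + 1))); last first.
  by rewrite [in LHS]vr ?[in RHS]vl ?mul0r//; lia.
rewrite (@grid_sum_shift n (fun k => v k * e k)); last first.
  by rewrite [in LHS]vr ?[in RHS]vl ?mul0r//; lia.
by rewrite /amplification -/q; ring.
Qed.

(* Forward differences only carry information to the left, so the artificial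
   condition at the right end of the grid is never felt. *)
Lemma solution_lattice (n m : nat) (g : R -> C) (f : R -> R -> C) (i : nat)
    (k : int) :
  (m + 2 <= n)%N ->
  discrete_heat_solution n (truncate m (meas_ext n g)) f ->
  i%:Z < n%:Z ^+ 2 -> - n%:Z ^+ 2 <= k < n%:Z ^+ 2 ->
  f (node R n i%:Z) (node R n k) =
  lattice_heat n (fun j => truncate m g (node R n j)) i k.
Proof.
move=> mn [_ f_heat f_init].
have n0 : (0 < n)%N by lia.
have n0' : 0 < n%:R :> R by rewrite ltr0n.
have n0C : n%:R != 0 :> C by rewrite pnatr_eq0 -lt0n.
set b := fun j => _.
have br j : (m * n)%N%:Z <= j -> b j = 0.
  move=> mj; rewrite /b /truncate ifF//; apply/negbTE; rewrite negb_and orbC.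
  by rewrite -leNgt /node ler_pdivlMr// -natrM -[(m * n)%:R]/((m * n)%N%:~R) ler_int mj.
elim: i k => [|i IH] k ni nk.
  rewrite /node mul0r f_init; last exact: node_space.
  by rewrite /= /b /truncate /meas_ext idx_node.
have i_time : heat_time n (node R n i).
  rewrite /heat_time /grid_time /node/=; split.
    apply/andP; split; first by rewrite divr_ge0.
    rewrite ltr_pdivrMr// -expr2.
    have -> : n%:R ^+ 2 = (n%:Z ^+ 2)%:~R :> R by rewrite rmorphXn.
    by rewrite ltr_int; lia.
  apply/negP; rewrite negb_and -ltNge ltr_pM2r ?invr_gt0//.
  have -> : n%:R ^+ 2 - 1 = (n%:Z ^+ 2 - 1)%:~R :> R.
    by rewrite rmorphB rmorphXn.
  by rewrite ltr_int; apply/orP; left; lia.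
(* The columns from [n ^ 2 - 2] on stay empty at all times, so the convention that [diff_x] is 0 in
   the last column agrees with the lattice. *)
have mn2 : (m * n)%N%:Z <= n%:Z ^+ 2 - 2.
  by have : ((m + 2) * n <= n * n)%N; [rewrite leq_mul2r mn orbT|nia].
have vr j : n%:Z ^+ 2 - 2 <= j -> lattice_heat n b i j = 0.
  by move=> nj; apply: (@lattice_heat_supp_right n b _ br i); lia.
have i_lt : i%:Z < n%:Z ^+ 2 by lia.
have dxE j : - n%:Z ^+ 2 <= j < n%:Z ^+ 2 ->
    diff_x n f (node R n i) (node R n j) =
    n%:R * (lattice_heat n b i (j + 1) - lattice_heat n b i j).
  move=> jn; rewrite /diff_x idx_node//; case: ifPn => jn2.
    by rewrite !IH//; lia.
  by rewrite !vr ?subrr ?mulr0//; lia.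
have := f_heat _ _ i_time (node_space n0 nk).
rewrite /diff_t idx_node// ifT; last by lia.
have -> : (i%:Z + 1) = i.+1%:Z by lia.
rewrite /diff_xx {1}/diff_x idx_node// (IH k)// => /eqP.
rewrite subr_eq add0r => /eqP /(canRL (mulKf n0C)) /(canRL (subrK _)) ->.
rewrite -[lattice_heat n b i.+1 k]/(lattice_heat n b i k + n%:R *
  (lattice_heat n b i (k + 2) - 2 * lattice_heat n b i (k + 1) +
   lattice_heat n b i k)) addrC; congr (_ + _).
case: ifPn => kn; last by rewrite !vr ?(mulr0, subr0, addr0)//; lia.
rewrite !dxE//; last by lia.
by have -> : k + 2 = k + 1 + 1; [rewrite -addrA|field].
Qed.

Definition heat_kernel (n M i : nat) (d : int) : C :=
  n%:R^-1 * grid_sum n (fun l =>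
    (if - (M%:Z * n%:Z) <= l <= M%:Z * n%:Z then 2^-1 else 0) *
    (expi (pi * node R n l * node R n d) * amplification n l ^+ i)).

(** The wrap moves [d] by a multiple of [2 n ^ 2], hence the phase by a multiple of [2 pi]: the
    modulus in the convolution disappears. *)
Lemma inv_transform_wrap (n M : nat) (t : R) (d : int) : (0 < n)%N ->
  inv_transform n (@cutoff R n M) t (grid_wrap n (node R n d)) =
  n%:R^-1 * grid_sum n (fun l =>
    (if - (M%:Z * n%:Z) <= l <= M%:Z * n%:Z then 2^-1 else 0) *
    expi (pi * node R n l * node R n d)).
Proof.
move=> n0; have n0' : n%:R != 0 :> R by rewrite pnatr_eq0 -lt0n.
rewrite /inv_transform /space_int /cutoff /grid_expi; congr (_ * _).
apply: eq_grid_sum => l _; rewrite !idx_node//; congr (_ * _).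
rewrite /grid_wrap; set q := Num.floor _.
have -> : node R n d - 2 * n%:R * q%:~R = node R n (d - 2 * n%:Z ^+ 2 * q).
  rewrite /node intrB !intrM.
  by rewrite -[n%:Z%:~R]/(n%:R) -[2%:~R]/(2%:R); field.
rewrite idx_node// -[LHS]mulr1 -(expi_2pi_int (l * q)) -expiD; congr expi.
rewrite /node !(intrB, intrM).
by rewrite -[n%:Z%:~R]/(n%:R) -[2%:~R]/(2%:R) -mulr_natl; field.
Qed.

(** Once the transform of the cutoff is expanded, the sum over space is the discrete transform of
    [f] at time [t], which [lattice_heat_dft] expresses by that of the datum. The bound on [idx n t]
    keeps the support, starting in [[-m, m)], away from the left end. *)
Lemma grid_conv_kernel (n m M : nat) (g : R -> C) (f : R -> R -> C) (t x : R) :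
  (m + 2 <= n)%N ->
  discrete_heat_solution n (truncate m (meas_ext n g)) f ->
  grid_time n t -> 2 * idx n t < (n * (n - m))%N%:Z - 2 ->
  grid_conv n (inv_transform n (@cutoff R n M)) f t x =
  n%:R^-1 * grid_sum n (fun k => truncate m g (node R n k) *
    heat_kernel n M `|idx n t|%N (idx n x - k)).
Proof.
move=> mn f_sol t_time tn; have n0 : (0 < n)%N by lia.
have n0R : 0 < n%:R :> R by rewrite ltr0n.
set b := fun j => truncate m g (node R n j).
have iE : idx n t = `|idx n t|%N.
  apply/esym/gez0_abs; rewrite /idx floor_ge0 mulr_ge0//.
  by move: t_time => /andP[].
set i := `|idx n t|%N in iE *.
have i_lt : i%:Z < n%:Z ^+ 2 by rewrite -iE; nia.
have br k : n%:Z ^+ 2 - 2 < k -> b k = 0.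
  move=> kn; rewrite /b /truncate ifF//; apply/negbTE; rewrite negb_and orbC.
  rewrite -leNgt /node ler_pdivlMr// -natrM -[(m * n)%:R]/((m * n)%N%:~R).
  by rewrite ler_int; have : ((m + 2) * n <= n * n)%N; 
    [rewrite leq_mul2r mn orbT|nia].
have bl k : k < - (m * n)%N%:Z -> b k = 0.
  move=> kn; rewrite /b /truncate ifF//; apply/negbTE; rewrite negb_and.
  rewrite -ltNge /node ltr_pdivrMr// mulNr -natrM -[(m * n)%:R]/((m * n)%N%:~R).
  by rewrite -mulrNz ltr_int kn.
transitivity (n%:R^-1 * grid_sum n (fun k => grid_sum n (fun l => n%:R^-1 *
    ((if - (M%:Z * n%:Z) <= l <= M%:Z * n%:Z then 2^-1 else 0) *
    expi (pi * node R n l * node R n (idx n x))) *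
    (lattice_heat n b i k * expi (- (pi * node R n l * node R n k)))))).
  rewrite /grid_conv; congr (_ * _); apply: eq_grid_sum => k kn.
  rewrite inv_transform_wrap//.
  have -> : f t (node R n k) = f (node R n i) (node R n k).
    case: f_sol => [f_meas _ _].
    have i_node : node R n i <= t < node R n (i%:Z + 1).
      rewrite /node ler_pdivrMr// ltr_pdivlMr// !(mulrC t) -iE.
      by rewrite /idx floor_le_tmp floorD1_gt.
    have i_time : grid_time n (node R n i).
      rewrite /grid_time/= /node divr_ge0//= ltr_pdivrMr// -expr2.
      have -> : n%:R ^+ 2 = (n%:Z ^+ 2)%:~R :> R by rewrite rmorphXn.
      by rewrite ltr_int.
    have k_cell : cell n k (node R n k).
      rewrite /cell/= lexx /node ltr_pM2r ?invr_gt0// ltr_int; lia.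
    apply: (f_meas i k) => //; [exact: node_space|exact: node_space|].
    rewrite /cell/= lexx /node ltr_pM2r ?invr_gt0// ltr_int; lia.
  rewrite (solution_lattice (m := m) (g := g))// -/b.
  rewrite mulrC mulrA -grid_sumZ; apply: eq_grid_sum => l _.
  have -> : pi * node R n l * node R n (idx n x - k) =
      pi * node R n l * node R n (idx n x) + - (pi * node R n l * node R n k).
    by rewrite /node intrB; field; rewrite gt_eqF.
  by rewrite expiD; ring.
rewrite exchange_grid_sum; congr (_ * _).
(* For fixed [l] the sum over [k] is the transform after [i] steps; it becomes the transform of the
   datum, and the sums are exchanged back. *)
under eq_grid_sum => l _.
  rewrite grid_sumZ (@lattice_heat_dft n b i (- (m * n)%N%:Z) l)//; last first.
    by rewrite opprK -iE; move: tn; rewrite mulnBr; nia.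
  rewrite mulrA -grid_sumZ.
over.
rewrite exchange_grid_sum; apply: eq_grid_sum => k _.
rewrite /heat_kernel mulrA -grid_sumZ; apply: eq_grid_sum => l _.
have -> : pi * node R n l * node R n (idx n x - k) =
    pi * node R n l * node R n (idx n x) + - (pi * node R n l * node R n k).
  by rewrite /node intrB; field; rewrite gt_eqF.
by rewrite expiD -[truncate _ _ _]/(b k); ring.
Qed.

End Grid.

(** * The filtered kernel *)

Section RealEstimates.
Set Implicit Arguments.
Unset Strict Implicit.
Context {R : realType}.

Lemma mean_value (f f' : R -> R) (a b : R) :
  (forall x : R, is_derive x (1 : R) f (f' x)) ->
  exists2 c, `|c - a| <= `|b - a| & f b - f a = f' c * (b - a).
Proof.
move=> fd; have f_cont (i : interval R) : {within [set` i], continuous f}.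
  by apply: derivable_within_continuous => x _; apply: ex_derive; exact: fd.
have [ab|ba] := leP a b.
  have [c] := @MVT_segment R f f' a b ab _ (f_cont _).
  rewrite in_itv/= => /andP[ac cb] ->; exists c => //.
  by rewrite !ger0_norm ?subr_ge0// lerD2r.
have [c] := @MVT_segment R f f' b a (ltW ba) _ (f_cont _).
rewrite in_itv/= => /andP[bc ca] e; exists c.
  by rewrite !ler0_norm ?subr_le0 ?(ltW ba)//; lra.
by rewrite -opprB e -mulrN opprB.
Qed.

(** The mean value theorem for [f] and then for [f']; hence [K] where Taylor's formula has
    [K / 2]. *)
Lemma taylor1_le (f f' f'' : R -> R) (a b K : R) :
  (forall x : R, is_derive x (1 : R) f (f' x)) ->
  (forall x : R, is_derive x (1 : R) f' (f'' x)) ->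
  (forall c, `|c - a| <= `|b - a| -> `|f'' c| <= K) ->
  `|f b - f a - (b - a) * f' a| <= K * (b - a) ^+ 2.
Proof.
move=> fd fd' fK; have [c ca ->] := mean_value a b fd.
rewrite (mulrC (b - a)) -mulrBl.
have [e ec ->] := mean_value a c fd'.
rewrite -mulrA normrM ler_pM//; first by apply: fK; exact: le_trans ca.
by rewrite -[leRHS]ger0_norm ?sqr_ge0// expr2 !normrM ler_wpM2r.
Qed.

Lemma norm_sin_le (x : R) : `|sin x| <= `|x|.
Proof.
have [c _] := @mean_value sin cos 0 x _.
rewrite sin0 !subr0 => ->; rewrite normrM ler_piMl//; exact: cos_max.
Qed.

Lemma norm_cosB1_le (x : R) : `|cos x - 1| <= x ^+ 2.
Proof.
have [c] := @mean_value cos (fun x => - sin x) 0 x _.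
rewrite cos0 !subr0 => cx ->; rewrite normrM normrN -(real_normK (num_real x)) expr2.
by rewrite ler_wpM2r// (le_trans (norm_sin_le _)).
Qed.

Lemma norm_cosB1_le1 (x : R) : `|cos x - 1| <= `|x|.
Proof.
have [c] := @mean_value cos (fun x => - sin x) 0 x _.
rewrite cos0 !subr0 => cx ->; rewrite normrM normrN ler_piMl//; exact: sin_max.
Qed.

Lemma norm_sinB_le (x : R) : `|sin x - x| <= x ^+ 2.
Proof.
have [c] := @mean_value (fun x => sin x - x) (fun x => cos x - 1) 0 x _.
rewrite sin0 !subr0 => cx ->; rewrite normrM -(real_normK (num_real x)) expr2.
by rewrite ler_wpM2r// (le_trans (norm_cosB1_le1 _)).
Qed.

(** From [expR (- u) <= (1 + u)^-1] and [(1 - u + u ^ 2) * (1 + u) = 1 + u ^ 3]. *)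
Lemma norm_expR_taylor_le (u : R) : 0 <= u -> `|expR (- u) - (1 - u)| <= u ^+ 2.
Proof.
move=> u0; rewrite ger0_norm ?subr_ge0 ?expR_ge1Dx//.
rewrite expRN lerBlDr; have u1 : 0 < 1 + u by lra.
apply: (@le_trans _ _ (1 + u)^-1).
  by rewrite lef_pV2 ?posrE ?expR_gt0// expR_ge1Dx.
rewrite -[leLHS]mul1r ler_pdivrMr//; have : 0 <= u ^+ 3 by exact: exprn_ge0.
by move=> u3; rewrite (_ : _ * _ = 1 + u ^+ 3); [lra|ring].
Qed.

(** From [expR u <= (1 - u)^-1]; and [(1 + 2 * u) * (1 - u) >= 1] exactly up to [u = 2^-1]. *)
Lemma expR_sub1_le (u : R) : 0 <= u <= 2^-1 -> expR u - 1 <= 2 * u.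
Proof.
move=> /andP[u0 u1]; have : 1 - u <= expR (- u) by exact: expR_ge1Dx.
rewrite expRN => h; have u2 : 0 < 1 - u by lra.
have : expR u <= (1 - u)^-1 by rewrite -[leLHS]invrK lef_pV2// posrE// invr_gt0 expR_gt0.
move=> /le_trans h'; rewrite lerBlDr; apply: h'.
by rewrite -[leLHS]mul1r ler_pdivrMr//; nra.
Qed.

End RealEstimates.

(** * The real-valued complex modulus, and powers of nearby complex numbers *)

Section ComplexEstimates.
Set Implicit Arguments.
Unset Strict Implicit.
Context {R : realType}.
Local Notation C := R[i].
Implicit Types (a b z : C).

Lemma normc_ge0 z : 0 <= normc z.
Proof. by case: z => x y; exact: sqrtr_ge0. Qed.

Lemma normcX z (i : nat) : normc (z ^+ i) = normc z ^+ i.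
Proof.
elim: i => [|i IH]; first by rewrite !expr0 normc1.
by rewrite !exprS normcM IH.
Qed.

Lemma normc_real (r : R) : normc r%:C = `|r|.
Proof. by rewrite /= expr0n addr0 sqrtr_sqr. Qed.

Lemma normc_nat (n : nat) : normc (n%:R : C) = n%:R.
Proof. by rewrite -(rmorph_nat (real_complex R)) normc_real ger0_norm. Qed.

Lemma normc_le z : normc z <= `|complex.Re z| + `|complex.Im z|.
Proof.
case: z => x y /=; rewrite -[leRHS]ger0_norm ?addr_ge0// -sqrtr_sqr.
rewrite ler_sqrt ?sqr_ge0// -(real_normK (num_real x)) -(real_normK (num_real y)).
by have := normr_ge0 x; have := normr_ge0 y; nra.
Qed.

Lemma normc_sum (I : Type) (r : seq I) (P : pred I) (u : I -> C) :
  normc (\sum_(i <- r | P i) u i) <= \sum_(i <- r | P i) normc (u i).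
Proof.
elim/big_rec2: _ => [|i x z _ IH]; first by rewrite normc0.
by rewrite (le_trans (le_normcD _ _))// lerD2l.
Qed.

(** The powers of [b] stay in the unit disc, so each step multiplies the old error by at most
    [1 + d] and adds at most [d]. *)
Lemma normc_subX_le a b (d : R) (i : nat) : normc b <= 1 -> normc (a - b) <= d ->
  normc (a ^+ i - b ^+ i) <= (1 + d) ^+ i - 1.
Proof.
move=> b1 abd; have d0 : 0 <= d by rewrite (le_trans _ abd)// normc_ge0.
have a1 : normc a <= 1 + d.
  by rewrite -[a](subrK b) addrC (le_trans (le_normcD _ _))// lerD.
elim: i => [|i IH]; first by rewrite !expr0 !subrr normc0.
have -> : a ^+ i.+1 - b ^+ i.+1 = a * (a ^+ i - b ^+ i) + (a - b) * b ^+ i.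
  by rewrite !exprS; ring.
rewrite (le_trans (le_normcD _ _))// !normcM normcX.
have -> : (1 + d) ^+ i.+1 - 1 = (1 + d) * ((1 + d) ^+ i - 1) + d * 1.
  by rewrite exprS; ring.
by rewrite lerD// ler_pM ?normc_ge0 ?exprn_ge0 ?exprn_ile1 ?normc_ge0.
Qed.

(** A difference of squares: [expi x - 1 - i x] is of second order and [expi x - 1 + i x] of
    first. *)
Lemma normc_expiB1_sqr_le (x : R) : `|x| <= 1 ->
  normc ((expi x - 1) ^+ 2 + (x ^+ 2)%:C) <= 8 * `|x| ^+ 3.
Proof.
move=> x1; have -> : (expi x - 1) ^+ 2 + (x ^+ 2)%:C =
    (expi x - 1 - 'i * x%:C) * (expi x - 1 + 'i * x%:C).
  by rewrite -subr_sqr exprMn sqr_i rmorphXn/= mulN1r opprK.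
have h1 : normc (expi x - 1 - 'i * x%:C) <= 2 * x ^+ 2.
  rewrite (le_trans (normc_le _))// /expi/=; simpc => /=.
  have := norm_cosB1_le x; have := norm_sinB_le x; lra.
have h2 : normc (expi x - 1 + 'i * x%:C) <= 4 * `|x|.
  rewrite (le_trans (normc_le _))// /expi/=; simpc => /=.
  have := normr_ge0 x; have := norm_cosB1_le1 x; have := norm_sin_le x; have := ler_normD (sin x) x; lra.
rewrite normcM (le_trans (ler_pM _ _ h1 h2)) ?normc_ge0//.
rewrite -(real_normK (num_real x)).
by have -> : 2 * `|x| ^+ 2 * (4 * `|x|) = 8 * `|x| ^+ 3 by ring.
Qed.

End ComplexEstimates.

(** * From the discrete kernel to the Gaussian cosine sum *)

Section KernelEstimates.
Set Implicit Arguments.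
Unset Strict Implicit.
Context {R : realType}.
Local Notation C := R[i].

(** Unlike that of [grid_sum], the range contains both ends, as in [cutoff]; its symmetry is what
    pairs exponentials into cosines. *)
Definition sym_sum (V : nmodType) (L : nat) (u : int -> V) : V :=
  \sum_(i < (2 * L).+1) u (i%:Z - L%:Z).

Lemma eq_sym_sum (V : nmodType) (L : nat) (u v : int -> V) :
  (forall l, - L%:Z <= l <= L%:Z -> u l = v l) -> sym_sum L u = sym_sum L v.
Proof.
move=> uv; apply: eq_bigr => i _; apply: uv.
by have := ltn_ord i; move: (nat_of_ord i) => {}i; lia.
Qed.

Lemma ler_sym_sum (L : nat) (u v : int -> R) :
  (forall l, - L%:Z <= l <= L%:Z -> u l <= v l) -> sym_sum L u <= sym_sum L v.
Proof.
move=> uv; apply: ler_sum => i _; apply: uv.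
by have := ltn_ord i; move: (nat_of_ord i) => {}i; lia.
Qed.

Lemma sym_sum_cst (L : nat) (c : R) : sym_sum L (fun=> c) = (2 * L + 1)%:R * c.
Proof. by rewrite /sym_sum big_const_ord iter_addr addr0 addn1 mulr_natl. Qed.

Lemma sym_sumB (V : zmodType) (L : nat) (u v : int -> V) :
  sym_sum L (fun l => u l - v l) = sym_sum L u - sym_sum L v.
Proof. exact: sumrB. Qed.

Lemma normc_sym_sum (L : nat) (u : int -> C) :
  normc (sym_sum L u) <= sym_sum L (fun l => normc (u l)).
Proof. exact: normc_sum. Qed.

Lemma sym_sum_opp (V : nmodType) (L : nat) (u : int -> V) :
  sym_sum L (fun l => u (- l)) = sym_sum L u.
Proof.
rewrite /sym_sum (reindex_inj rev_ord_inj)/=; apply: eq_bigr => i _.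
by congr u; have := ltn_ord i; move: (nat_of_ord i) => {}i; lia.
Qed.

Lemma grid_sum_sym (n L : nat) (v : int -> C) : L%:Z < n%:Z ^+ 2 ->
  grid_sum n (fun l => (if - L%:Z <= l <= L%:Z then 2^-1 else 0) * v l) =
  2^-1 * sym_sum L v.
Proof.
move=> Ln; set F := fun l => _; rewrite /grid_sum.
rewrite -(big_mkord xpredT (fun i => F (i%:Z - n%:Z ^+ 2))).
rewrite (@big_cat_nat _ _ _ (n ^ 2 - L) 0)//=; last by lia.
rewrite (@big_cat_nat _ _ _ (n ^ 2 + L).+1 (n ^ 2 - L))//=; [|lia|lia].
rewrite big_nat big1 ?add0r; last first.
  by move=> i iL; rewrite /F ifF ?mul0r//; lia.
rewrite [X in _ + X]big_nat [X in _ + X]big1 ?addr0; last first.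
  by move=> i iL; rewrite /F ifF ?mul0r//; lia.
rewrite -{1}[(n ^ 2 - L)%N]add0n big_addn.
have -> : ((n ^ 2 + L).+1 - (n ^ 2 - L) = (2 * L).+1)%N by lia.
rewrite big_mkord /sym_sum mulr_sumr; apply: eq_bigr => i _.
have -> : (i + (n ^ 2 - L))%N%:Z - n%:Z ^+ 2 = i%:Z - L%:Z by lia.
rewrite /F ifT//; have := ltn_ord i; move: (nat_of_ord i) => {}i; lia.
Qed.

Lemma cos_expi (a : R) : (cos a)%:C = 2^-1 * (expi a + expi (- a)).
Proof.
apply: (@mulfI _ 2); first by rewrite pnatr_eq0.
rewrite mulrA divff ?pnatr_eq0// mul1r mulr_natl mulr2n /expi cosN sinN.
by simpc.
Qed.

(** For the node [y] of index [l], the [i]-th power is the heat multiplier [exp (- pi ^ 2 y ^ 2 t)]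
    at [t = i / n]. *)
Definition heat_factor (n : nat) (l : int) : R :=
  expR (- (n%:R * (pi * node R n l / n%:R) ^+ 2)).

Lemma norm_node_le (n M : nat) (l : int) : (0 < n)%N ->
  - (M * n)%N%:Z <= l <= (M * n)%N%:Z -> `|node R n l| <= M%:R.
Proof.
move=> n0 /andP[l1 l2]; rewrite ler_norml /node ler_pdivrMr ?ltr0n//.
rewrite ler_pdivlMr ?ltr0n// mulNr -natrM -[(M * n)%:R]/((M * n)%N%:~R).
by rewrite -mulrNz !ler_int l1.
Qed.

(** Let [th = pi y / n], at most [pi M / n]. Squaring [expi th - 1] costs [8 n th ^ 3], linearizing
    the exponential costs [(n th ^ 2) ^ 2]; these give the two summands of the constant. *)
Lemma amplification_factor_le (n M : nat) (l : int) : (0 < M)%N ->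
  pi * M%:R <= n%:R :> R -> - (M * n)%N%:Z <= l <= (M * n)%N%:Z ->
  normc (amplification (R:=R) n l - (heat_factor n l)%:C) <=
  (8 * pi ^+ 3 + pi ^+ 4) * M%:R ^+ 4 / n%:R ^+ 2.
Proof.
move=> M0 Mn lM; have pi0 := @pi_gt0 R.
have M1 : 1 <= M%:R :> R by rewrite ler1n.
have n0R : 0 < n%:R :> R by apply: lt_le_trans Mn; rewrite mulr_gt0// ltr0n.
have n0 : (0 < n)%N by rewrite ltr0n in n0R.
rewrite /heat_factor; set th := pi * node R n l / n%:R.
pose T : R := pi * M%:R / n%:R.
have thT : `|th| <= T.
  rewrite /th /T 2!normrM (ger0_norm (ltW pi0)) (@ger0_norm _ n%:R^-1)//.
  by rewrite ler_pM2r ?invr_gt0// ler_pM2l// norm_node_le.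
have T1 : T <= 1 by rewrite ler_pdivrMr// mul1r.
have -> : amplification (R:=R) n l - (expR (- (n%:R * th ^+ 2)))%:C =
    n%:R * ((expi th - 1) ^+ 2 + (th ^+ 2)%:C) -
    (expR (- (n%:R * th ^+ 2)) - (1 - n%:R * th ^+ 2))%:C.
  rewrite /amplification -/th !(rmorphB, rmorphM, rmorph1)/= rmorph_nat.
  by ring.
rewrite (le_trans (le_normcD _ _))// normcN normcM normc_nat normc_real.
have h1 := normc_expiB1_sqr_le (le_trans thT T1).
have h2 := @norm_expR_taylor_le R (n%:R * th ^+ 2) (mulr_ge0 (ltW n0R) (sqr_ge0 _)).
apply: (@le_trans _ _ (n%:R * (8 * T ^+ 3) + (n%:R * T ^+ 2) ^+ 2)).
  rewrite lerD//.
    rewrite (ler_wpM2l (ltW n0R))// (le_trans h1)// ler_wpM2l// lerXn2r ?nnegrE//.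
    exact: le_trans thT.
  have n_th : 0 <= n%:R * th ^+ 2 by rewrite mulr_ge0 ?sqr_ge0// ltW.
  have th_T : n%:R * th ^+ 2 <= n%:R * T ^+ 2.
    rewrite (ler_wpM2l (ltW n0R))// -(real_normK (num_real th)).
    by rewrite lerXn2r ?nnegrE// (le_trans _ thT).
  by rewrite (le_trans h2)// lerXn2r ?nnegrE// (le_trans n_th).
have -> : n%:R * (8 * T ^+ 3) + (n%:R * T ^+ 2) ^+ 2 =
    (8 * pi ^+ 3 * M%:R ^+ 3 + pi ^+ 4 * M%:R ^+ 4) / n%:R ^+ 2.
  by rewrite /T; field; rewrite gt_eqF.
apply: ler_wpM2r; first by rewrite invr_ge0 exprn_ge0// ltW.
rewrite [leRHS]mulrDl lerD2r; apply: ler_wpM2l.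
  by rewrite mulr_ge0// exprn_ge0// ltW.
by rewrite [leRHS]exprS ler_peMl// exprn_ge0// ltW// ltr0n.
Qed.

(** An error [d] per step compounds to [(1 + d) ^ i - 1 <= exp (i d) - 1], which is at most [2 i d]
    while [i d <= 1/2]. *)
Lemma amplification_factorX_le (n M i : nat) (l : int) (e : R) : (0 < M)%N ->
  pi * M%:R <= n%:R :> R -> - (M * n)%N%:Z <= l <= (M * n)%N%:Z ->
  i%:R * ((8 * pi ^+ 3 + pi ^+ 4) * M%:R ^+ 4 / n%:R ^+ 2) <= e -> e <= 2^-1 ->
  normc (amplification (R:=R) n l ^+ i - (heat_factor n l ^+ i)%:C) <= 2 * e.
Proof.
move=> M0 Mn lM; move: (amplification_factor_le M0 Mn lM).
move: ((8 * pi ^+ 3 + pi ^+ 4) * _ / _) => d ad ie e2.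
have d0 : 0 <= d by apply: le_trans ad; exact: normc_ge0.
rewrite rmorphXn/=.
have w1 : normc (heat_factor n l)%:C <= 1.
  rewrite normc_real ger0_norm ?expR_ge0// /heat_factor -expR0 ler_expR.
  by rewrite oppr_le0 mulr_ge0// sqr_ge0.
rewrite (le_trans (normc_subX_le i w1 ad))//.
have id0 : 0 <= i%:R * d by rewrite mulr_ge0.
apply: (@le_trans _ _ (expR (i%:R * d) - 1)).
  by rewrite lerB// expRM_natl lerXn2r ?nnegrE ?expR_ge0 ?addr_ge0// expR_ge1Dx.
have : 0 <= i%:R * d <= 2^-1 by rewrite id0/=; lra.
by move=> /expR_sub1_le; lra.
Qed.

Definition gauss_sum (n M : nat) (tau z : R) : R :=
  (2 * n%:R)^-1 * sym_sum (M * n) (fun l =>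
    cos (pi * node R n l * z) * expR (- (pi ^+ 2 * tau * node R n l ^+ 2))).

Lemma heat_kernel_gauss_sum_le (n M i : nat) (d : int) (e : R) : (0 < M < n)%N ->
  pi * M%:R <= n%:R :> R ->
  i%:R * ((8 * pi ^+ 3 + pi ^+ 4) * M%:R ^+ 4 / n%:R ^+ 2) <= e -> e <= 2^-1 ->
  normc (heat_kernel n M i d -
    (gauss_sum n M (i%:R / n%:R) (node R n d))%:C) <= (2 * M%:R + 1) * e.
Proof.
move=> /andP[M0 Mn] piM ie e2; have n0 : (0 < n)%N by lia.
have n0R : 0 < n%:R :> R by rewrite ltr0n.
rewrite /heat_kernel; move: (node R n d) => y; pose w l := heat_factor n l ^+ i.
have wE l : w l = expR (- (pi ^+ 2 * (i%:R / n%:R) * node R n l ^+ 2)).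
  rewrite /w /heat_factor -expRM_natl; congr expR.
  by field; rewrite gt_eqF.
have MnE : M%:Z * n%:Z = (M * n)%N%:Z by rewrite PoszM.
rewrite MnE grid_sum_sym; last by nia.
have -> : (gauss_sum n M (i%:R / n%:R) y)%:C = n%:R^-1 * (2^-1 *
    sym_sum (M * n) (fun l => expi (pi * node R n l * y) * (w l)%:C)).
  rewrite /gauss_sum invfM rmorphM/= rmorphM/= !fmorphV/= !rmorph_nat.
  rewrite [in LHS](mulrC 2^-1) -mulrA; congr (_ * (_ * _)).
  set u := fun l => expi _ * _.
  (* The Gaussian weight is even, so the terms at [l] and [- l] combine to a real cosine. *)
  have -> : sym_sum (M * n) u = 2^-1 * (sym_sum (M * n) (fun l => u l + u (- l))).
    rewrite /sym_sum big_split/= -/(sym_sum _ u).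
    by rewrite -/(sym_sum _ (fun l => u (- l))) sym_sum_opp; field.
  rewrite /sym_sum rmorph_sum/= mulr_sumr; apply: eq_bigr => k _.
  set l := k%:Z - _; rewrite /u -wE.
  have -> : w (- l) = w l by rewrite !wE /node mulrNz mulNr sqrrN.
  have -> : pi * node R n (- l) * y = - (pi * node R n l * y).
    by rewrite /node mulrNz; ring.
  by rewrite -mulrDl rmorphM/= [RHS]mulrA -cos_expi.
rewrite -!mulrBr.
rewrite !normcM !normcV !normc_nat.
rewrite mulrA -invfM -ler_pdivlMl ?invr_gt0 ?mulr_gt0// invrK.
rewrite -sym_sumB (le_trans (normc_sym_sum _ _))//.
apply: (@le_trans _ _ (sym_sum (M * n) (fun=> 2 * e))).
  apply: ler_sym_sum => l lM; rewrite -mulrBr normcM normc_expi mul1r.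
  exact: amplification_factorX_le lM ie e2.
rewrite sym_sum_cst natrD !natrM.
have e0 : 0 <= e.
  apply: le_trans ie; rewrite !mulr_ge0 ?invr_ge0 ?exprn_ge0// addr_ge0//.
    by rewrite mulr_ge0// exprn_ge0// pi_ge0.
  by rewrite exprn_ge0// pi_ge0.
have : 1 <= n%:R :> R by rewrite ler1n.
by nra.
Qed.

End KernelEstimates.

(** * The Gaussian cosine sum as an approximate solution of a differential equation *)

Section GaussSum.
Set Implicit Arguments.
Unset Strict Implicit.
Context {R : realType}.

(** Each term [f' / n] is compared with the increment of [f] over one mesh, and the increments
    telescope. The last one reaches a mesh beyond [M], whence the bound on [f''] up to [M + 1]. *)
Lemma sym_sum_derive_le (n M : nat) (f f' f'' : R -> R) (K : R) : (0 < n)%N ->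
  (forall x : R, is_derive x (1 : R) f (f' x)) ->
  (forall x : R, is_derive x (1 : R) f' (f'' x)) ->
  (forall c, `|c| <= M%:R + 1 -> `|f'' c| <= K) ->
  `|n%:R^-1 * sym_sum (M * n) (fun l => f' (node R n l))| <=
  `|f (M%:R + n%:R^-1)| + `|f (- M%:R)| +
  (2 * M * n + 1)%:R * (K * n%:R^-1 ^+ 2).
Proof.
move=> n0 fd fd' fK; have n0R : 0 < n%:R :> R by rewrite ltr0n.
have n1R : n%:R^-1 <= 1 :> R by rewrite invf_le1// ler1n.
have nodeS l : node R n (l + 1) - node R n l = n%:R^-1.
  by rewrite /node intrD; field; rewrite gt_eqF.
set S := sym_sum _ _.
have tele : sym_sum (M * n) (fun l => f (node R n (l + 1)) - f (node R n l)) =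
    f (M%:R + n%:R^-1) - f (- M%:R).
  rewrite /sym_sum -(big_mkord xpredT (fun i : nat =>
    f (node R n (i%:Z - (M * n)%N%:Z + 1)) - f (node R n (i%:Z - (M * n)%N%:Z)))).
  rewrite (eq_bigr (fun i : nat => f (node R n (i.+1%:Z - (M * n)%N%:Z)) -
    f (node R n (i%:Z - (M * n)%N%:Z)))); last first.
    by move=> i _; congr (f (node R n _) - _); lia.
  rewrite (telescope_sumr (fun i : nat => f (node R n (i%:Z - (M * n)%N%:Z))))//.
  congr (f _ - f _); rewrite /node.
    have -> : (2 * (M * n)).+1%:Z - (M * n)%N%:Z = (M * n)%N%:Z + 1 by lia.
    by rewrite intrD -[(M * n)%N%:~R]/((M * n)%:R) natrM; field; rewrite gt_eqF.
  rewrite sub0r mulrNz -[(M * n)%N%:~R]/((M * n)%:R) natrM mulNr mulfK//.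
  by rewrite gt_eqF.
have dS : `|f (M%:R + n%:R^-1) - f (- M%:R) - n%:R^-1 * S| <=
    (2 * M * n + 1)%:R * (K * n%:R^-1 ^+ 2).
  rewrite -tele /S /sym_sum mulr_sumr -sumrB (le_trans (ler_norm_sum _ _ _))//.
  rewrite -mulnA -sym_sum_cst; apply: ler_sum => i _.
  set l := i%:Z - _; have lM : - (M * n)%N%:Z <= l <= (M * n)%N%:Z.
    by rewrite /l; have := ltn_ord i; move: (nat_of_ord i) => k; lia.
  rewrite -(nodeS l); apply: (taylor1_le fd fd') => c; rewrite nodeS => cl.
  apply: fK; rewrite -(subrK (node R n l) c) (le_trans (ler_normD _ _))// addrC.
  by rewrite lerD ?norm_node_le// (le_trans cl)// ger0_norm.
have -> : n%:R^-1 * S = f (M%:R + n%:R^-1) - f (- M%:R) -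
  (f (M%:R + n%:R^-1) - f (- M%:R) - n%:R^-1 * S) by ring.
by rewrite (le_trans (ler_normB _ _))// lerD// ler_normB.
Qed.

(** The summand is the derivative in [y] of [sin (a y) exp (- b y ^ 2)], which the Gaussian makes
    small at both ends. *)
Lemma sin_gauss_sum_le (n M : nat) (a b : R) : (0 < n)%N -> 0 <= b ->
  `|n%:R^-1 * sym_sum (M * n) (fun l =>
     (a * cos (a * node R n l) - 2 * b * node R n l * sin (a * node R n l)) *
     expR (- (b * node R n l ^+ 2)))| <=
  2 * expR (- (b * M%:R ^+ 2)) + (2 * M * n + 1)%:R *
  ((a ^+ 2 + 2 * b + 4 * `|a| * b * (M%:R + 1) + 4 * b ^+ 2 * (M%:R + 1) ^+ 2)
    * n%:R^-1 ^+ 2).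
Proof.
move=> n0 b0; pose q y := sin (a * y) * expR (- (b * y ^+ 2)).
pose q' y := (a * cos (a * y) - 2 * b * y * sin (a * y)) * expR (- (b * y ^+ 2)).
pose q'' y := (- a ^+ 2 * sin (a * y) - 2 * b * sin (a * y) -
  4 * a * b * y * cos (a * y) + 4 * b ^+ 2 * y ^+ 2 * sin (a * y)) *
  expR (- (b * y ^+ 2)).
have qd (x : R) : is_derive x (1 : R) q (q' x).
  by apply: is_derive_eq; rewrite /q' /GRing.scale/=; ring.
have qd' (x : R) : is_derive x (1 : R) q' (q'' x).
  by apply: is_derive_eq; rewrite /q'' /GRing.scale/=; ring.
have e1 y : expR (- (b * y ^+ 2)) <= 1.
  by rewrite -expR0 ler_expR oppr_le0 mulr_ge0// sqr_ge0.
have Y0 : 0 <= M%:R + 1 :> R by rewrite addr_ge0.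
pose K := a ^+ 2 + 2 * b + 4 * `|a| * b * (M%:R + 1) +
  4 * b ^+ 2 * (M%:R + 1) ^+ 2.
apply: le_trans (@sym_sum_derive_le n M q q' q'' K n0 qd qd' _) _.
  move=> c cM; rewrite /q'' normrM [X in _ * X]ger0_norm ?expR_ge0//.
  rewrite (le_trans (ler_piMr (normr_ge0 _) (e1 c)))//.
  have sc := sin_max (a * c); have cc := cos_max (a * c).
  rewrite (le_trans (ler_normD _ _))// lerD//; last first.
    rewrite normrM (le_trans (ler_piMr (normr_ge0 _) sc))// normrM.
    rewrite ger0_norm ?mulr_ge0 ?sqr_ge0// ler_wpM2l ?mulr_ge0 ?sqr_ge0//.
    by rewrite normrX lerXn2r ?nnegrE.
  rewrite (le_trans (ler_normB _ _))// lerD//; last first.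
    rewrite normrM (le_trans (ler_piMr (normr_ge0 _) cc))// !normrM.
    by rewrite (ger0_norm b0) (@ger0_norm _ 4)// ler_wpM2l// !mulr_ge0.
  rewrite (le_trans (ler_normB _ _))// lerD//.
    by rewrite normrM normrN normrX real_normK ?num_real// ler_piMr ?sqr_ge0.
  rewrite normrM ger0_norm ?mulr_ge0// ler_piMr// mulr_ge0//.
rewrite lerD2r; have qle y : `|q y| <= expR (- (b * y ^+ 2)).
  by rewrite /q normrM [X in _ * X]ger0_norm ?expR_ge0// ler_piMl ?expR_ge0// sin_max.
rewrite [leRHS](_ : _ = expR (- (b * M%:R ^+ 2)) + expR (- (b * M%:R ^+ 2))); last first.
  by ring.
rewrite lerD// (le_trans (qle _))// ?sqrrN// ler_expR lerN2 ler_wpM2l//.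
by rewrite lerXn2r ?nnegrE ?addr_ge0 ?invr_ge0// lerDl invr_ge0.
Qed.

(* [G x = S x * expR (x ^ 2 / 4 tau)] has derivative [r x] times a factor that
   increases with [|x|], where [r] is the telescoping sum of [sin_gauss_sum_le]. *)
Lemma gauss_sum_ode_le (n M : nat) (tau z : R) : (0 < n)%N -> (0 < M)%N ->
  0 < tau -> `|z| <= M%:R ->
  `|gauss_sum n M tau z - gauss_sum n M tau 0 * expR (- (z ^+ 2 / (4 * tau)))|
  <= M%:R / (4 * pi * tau) * (2 * expR (- (pi ^+ 2 * tau * M%:R ^+ 2)) +
     3 * (pi ^+ 2 + 2 * (pi ^+ 2 * tau) + 8 * pi * (pi ^+ 2 * tau) +
      16 * (pi ^+ 2 * tau) ^+ 2) * M%:R ^+ 3 / n%:R).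
Proof.
move=> n0 M0 tau0 zM.
have n0R : 0 < n%:R :> R by rewrite ltr0n.
have n1R : 1 <= n%:R :> R by rewrite ler1n.
have M1R : 1 <= M%:R :> R by rewrite ler1n.
have pi0 := @pi_gt0 R.
set b := pi ^+ 2 * tau; have b0 : 0 < b by rewrite mulr_gt0// exprn_gt0.
set E := 2 * _ + _.
have E0 : 0 <= E.
  rewrite /E addr_ge0 ?mulr_ge0 ?expR_ge0// ?exprn_ge0 ?invr_ge0 ?(ltW n0R)//.
  by rewrite !addr_ge0 ?exprn_ge0 ?mulr_ge0 ?exprn_ge0// ltW.
pose S := gauss_sum n M tau.
pose r x := n%:R^-1 * sym_sum (M * n) (fun l =>
     (pi * x * cos (pi * x * node R n l) -
      2 * b * node R n l * sin (pi * x * node R n l)) *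
     expR (- (b * node R n l ^+ 2))).
have rE x : `|x| <= M%:R -> `|r x| <= E.
  move=> xM; apply: le_trans (@sin_gauss_sum_le n M (pi * x) b n0 (ltW b0)) _.
  rewrite /E lerD2l.
  set K := (X in _ * (X * _) <= _); set K' := (X in _ <= 3 * X * _ / _).
  (* [|x| <= M] and [M + 1 <= 2 * M] allow [M ^ 2] to be taken out; the doubling turns the
     coefficients 4 and 4 of [K] into 8 and 16. *)
  have KK : K <= K' * M%:R ^+ 2.
    have x2 : x ^+ 2 <= M%:R ^+ 2.
      by rewrite -(real_normK (num_real x)) lerXn2r ?nnegrE.
    have pix : (pi * x) ^+ 2 <= pi ^+ 2 * M%:R ^+ 2.
      by rewrite exprMn ler_wpM2l// sqr_ge0.
    have h1 : `|pi * x| <= pi * M%:R.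
      by rewrite normrM gtr0_norm// ler_wpM2l// ltW.
    have h2 : `|pi * x| * b * (M%:R + 1) <= pi * M%:R * b * (2 * M%:R).
      have h1b : `|pi * x| * b <= pi * M%:R * b by rewrite ler_wpM2r// ltW.
      apply: ler_pM => //; last by lra.
        by rewrite mulr_ge0// ltW.
    have h3 : b ^+ 2 * (M%:R + 1) ^+ 2 <= b ^+ 2 * (2 * M%:R) ^+ 2.
      rewrite ler_wpM2l ?sqr_ge0// lerXn2r ?nnegrE ?addr_ge0 ?mulr_ge0//; lra.
    have h4 : b <= b * M%:R ^+ 2 by rewrite ler_peMr ?(ltW b0)// exprn_ege1.
    by rewrite /K /K'; lra.
  have K0 : 0 <= K.
    by do ![exact: sqr_ge0 | exact: ltW | by [] | apply: addr_ge0 | apply: mulr_ge0].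
  have K'0 : 0 <= K'.
    by rewrite /K' !addr_ge0 ?exprn_ge0 ?mulr_ge0 ?exprn_ge0// ltW.
  have -> : 3 * K' * M%:R ^+ 3 / n%:R =
      (3 * M%:R * n%:R) * ((K' * M%:R ^+ 2) * n%:R^-1 ^+ 2).
    by field; rewrite gt_eqF.
  rewrite ler_pM//.
    by rewrite mulr_ge0 ?sqr_ge0.
    rewrite natrD !natrM; nra.
  by rewrite ler_wpM2r// sqr_ge0.
(* The cosine part of [r] is [2 pi x S], and its sine part is [4 pi tau S']. Without [r] this is the
   equation solved by [exp (- x ^ 2 / 4 tau)]. *)
have Sd (x : R) : is_derive x (1 : R) S ((4 * pi * tau)^-1 * r x - x / (2 * tau) * S x).
  have [y yE] : exists y : nat -> R,
      forall i : nat, node R n (i%:Z - (M * n)%N%:Z) = y i.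
    by exists (fun i => node R n (i%:Z - (M * n)%N%:Z)).
  pose h (i : 'I_(2 * (M * n)).+1) (x : R) :=
    cos (pi * y i * x) * expR (- (b * y i ^+ 2)).
  have SE : S = (2 * n%:R)^-1 \*: (\sum_i h i).
    apply/funext => u; rewrite /= fct_sumE; congr (_ * _).
    by apply: eq_bigr => i _; rewrite yE.
  have hd i : is_derive x (1 : R) (h i)
      (- (pi * y i * sin (pi * y i * x) * expR (- (b * y i ^+ 2)))).
    by apply: is_derive_eq; rewrite /GRing.scale/=; ring.
  rewrite {1}SE; apply: is_derive_eq; rewrite /GRing.scale/=.
  rewrite /r /S /gauss_sum /sym_sum !mulr_sumr -sumrB; apply: eq_bigr => i _.
  rewrite yE -/b; have -> : pi * x * y i = pi * y i * x by ring.
  move: (expR _) (sin _) (cos _) => u v w.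
  rewrite /b; move: pi pi0 => p p0.
  by field; rewrite !gt_eqF.
pose G x := S x * expR (x ^+ 2 / (4 * tau)).
have Gd (x : R) : is_derive x (1 : R) G
    ((4 * pi * tau)^-1 * r x * expR (x ^+ 2 / (4 * tau))).
  apply: is_derive_eq; rewrite /GRing.scale/=.
  move: (S x) (r x) (expR _) pi pi0 => s r' e p p0.
  by field; rewrite !gt_eqF.
have [c cz Gz] := mean_value 0 z Gd; rewrite !subr0 in cz Gz.
set u := z ^+ 2 / (4 * tau).
have -> : S z - S 0 * expR (- u) = (G z - G 0) * expR (- u).
  rewrite /G expr0n/= mul0r expR0 mulr1 mulrBl -(mulrA (S z)) -expRD subrr.
  by rewrite expR0 mulr1.
have -> : (G z - G 0) * expR (- u) = z * (4 * pi * tau)^-1 *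
    (r c * (expR (c ^+ 2 / (4 * tau)) * expR (- u))) by rewrite Gz; ring.
have tau4 : 0 < 4 * tau by rewrite mulr_gt0.
have e1 : expR (c ^+ 2 / (4 * tau)) * expR (- u) <= 1.
  rewrite -expRD -[leRHS]expR0 ler_expR subr_le0 /u ler_pM2r ?invr_gt0//.
  by rewrite -(real_normK (num_real c)) -(real_normK (num_real z)) lerXn2r ?nnegrE.
have pt0 : 0 < 4 * pi * tau by rewrite !mulr_gt0.
rewrite normrM ler_pM//.
  by rewrite normrM [X in _ * X]gtr0_norm ?invr_gt0// ler_wpM2r// invr_ge0 ltW.
rewrite normrM (le_trans _ (rE c (le_trans cz zM)))// ler_piMr//.
by rewrite ger0_norm// mulr_ge0 ?expR_ge0.
Qed.

End GaussSum.

(** * Riemann sums *)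

Section GaussianIntegral.
Set Implicit Arguments.
Unset Strict Implicit.
Context {R : realType}.
Notation mu := (@lebesgue_measure R).

Lemma gaussian_integral (c : R) : 0 < c ->
  mu.-integrable setT (EFin \o (fun y => expR (- (c * y ^+ 2)))) /\
  \int[mu]_(y in [set: R]) expR (- (c * y ^+ 2)) = Num.sqrt (pi / c).
Proof.
(* The standard deviation of the centred normal law whose density is proportional to this
   Gaussian. *)
move=> c0; pose s := Num.sqrt (2 * c)^-1.
have s2 : s ^+ 2 = (2 * c)^-1 by rewrite sqr_sqrtr// invr_ge0 mulr_ge0// ltW.
have s0 : s != 0 by rewrite sqrtr_eq0 -ltNge invr_gt0 mulr_gt0.
have p0 : normal_peak s != 0 by rewrite gt_eqF// normal_peak_gt0.
have E : (fun y => expR (- (c * y ^+ 2))) =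
    (fun y => (normal_peak s)^-1 * normal_pdf 0 s y).
  apply/funext => y; rewrite normal_pdfE// mulKf// /normal_fun.
  by congr expR; rewrite subr0 s2; field; rewrite gt_eqF.
have int_pdf : mu.-integrable setT (EFin \o normal_pdf 0 s).
  exact: integrable_normal_pdf.
rewrite E; split.
  rewrite [X in mu.-integrable _ X](_ : _ = (fun y => (normal_peak s)^-1%:E *
    (normal_pdf 0 s y)%:E)%E); last by apply/funext => y; rewrite /= EFinM.
  exact: integrableZl.
rewrite RintegralZl//.
rewrite /Rintegral integral_normal_pdf/= mulr1 /normal_peak invrK; congr Num.sqrt.
by rewrite s2 -mulr_natr; field; rewrite gt_eqF.
Qed.

(** Its integral is exactly the Riemann sum, which brings such sums within reach of dominated
    convergence. Linearity handles this form; pointwise limits use [step_funE]. *)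
Definition step_fun (n N : nat) (c : int) (u : int -> R) (y : R) : R :=
  \sum_(i < N) u (i%:Z - c) * \1_(cell n (i%:Z - c)) y.

Lemma cell_idx (n : nat) (j : int) (y : R) : (0 < n)%N ->
  \1_(cell n j) y = (idx n y == j)%:R :> R.
Proof.
move=> n0; rewrite indicE; congr (_%:R); congr nat_of_bool.
have n0R : 0 < n%:R :> R by rewrite ltr0n.
apply/idP/idP => [|/eqP <-].
  rewrite inE /cell/= /node ler_pdivrMr// ltr_pdivlMr// !(mulrC y) => yj.
  by apply/eqP; rewrite /idx; apply: floor_def.
rewrite inE /cell/= /node ler_pdivrMr// ltr_pdivlMr// !(mulrC y).
by rewrite /idx floor_le_tmp floorD1_gt.
Qed.

Lemma step_funE (n N : nat) (c : int) (u : int -> R) (y : R) : (0 < n)%N ->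
  step_fun n N c u y =
  if - c <= idx n y < N%:Z - c then u (idx n y) else 0.
Proof.
move=> n0; rewrite /step_fun; case: ifPn => [yc|yc]; last first.
  rewrite big1// => i _; rewrite cell_idx//.
  case: eqP => [yi|_]; rewrite ?mulr0//; exfalso; move: yc.
  by rewrite yi => /negP; apply; have := ltn_ord i; move: (nat_of_ord i) => k; lia.
have iN : (`|(idx n y + c)%R| < N)%N by lia.
rewrite (bigD1 (Ordinal iN))//= big1 ?addr0; last first.
  move=> i /eqP iy; rewrite cell_idx//; case: eqP => [yi|_]; rewrite ?mulr0//.
  by exfalso; apply: iy; apply: val_inj => /=; lia.
rewrite cell_idx//; have -> : `|(idx n y + c)%R|%N%:Z - c = idx n y by lia.
by rewrite eqxx mulr1.
Qed.

Lemma integral_step_fun (n N : nat) (c : int) (u : int -> R) : (0 < n)%N ->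
  measurable_fun setT (step_fun n N c u) /\
  (\int[mu]_y (step_fun n N c u y)%:E)%E =
    (n%:R^-1 * \sum_(i < N) u (i%:Z - c))%:E.
Proof.
move=> n0; have cellE j : cell n j = [set` `[node R n j, node R n (j + 1)[].
  by apply/seteqP; split => y; rewrite /= in_itv.
have mcell j : measurable (cell n j : set R) by rewrite cellE; exact: measurable_itv.
have cell_int j : mu.-integrable setT (EFin \o (\1_(cell n j) : R -> R)).
  by rewrite cellE; exact: integrable_indic_itv.
split.
  rewrite /step_fun; apply: measurable_sum => i.
  by apply: measurable_funM => //; exact: measurable_indic.
under eq_integral do rewrite /step_fun -sumEFin.
rewrite integral_sum//; last first.
  move=> i; rewrite [X in mu.-integrable _ X](_ : _ = (fun y =>
    (u (i%:Z - c))%:E * (\1_(cell n (i%:Z - c)) y)%:E)%E).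
    by apply: integrableZl => //; exact: cell_int.
  by apply/funext => y; rewrite EFinM.
rewrite mulr_sumr -sumEFin; apply: eq_bigr => i _.
under eq_integral do rewrite EFinM.
rewrite integralZl//; last exact: cell_int.
rewrite integral_indic//; last exact: mcell.
rewrite setIT mulrC EFinM; congr (_ * _)%E.
rewrite cellE; etransitivity; first exact: lebesgue_measure_itv.
rewrite /= lte_fin -EFinB.
have d : node R n (i%:Z - c + 1) - node R n (i%:Z - c) = n%:R^-1.
  by rewrite /node intrD; field; rewrite pnatr_eq0 -lt0n.
by rewrite -subr_gt0 d invr_gt0 ltr0n n0.
Qed.

Lemma node_idx_itv (n : nat) (y : R) : (0 < n)%N ->
  node R n (idx n y) <= y < node R n (idx n y) + n%:R^-1.
Proof.
move=> n0; have : \1_(cell n (idx n y)) y = 1 :> R by rewrite cell_idx// eqxx.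
rewrite indicE; case: (boolP (y \in _)) => [|_ /eqP]; last by rewrite eq_sym oner_eq0.
by rewrite inE /cell/= => + _; rewrite /node intrD mulrDl mul1r.
Qed.

Lemma cvg_node_idx (n : nat -> nat) (s : nat -> R) (l : R) :
  (forall k, (0 < n k)%N) -> (forall k, (k <= n k)%N) ->
  s @ \oo --> l -> node R (n k) (idx (n k) (s k)) @[k --> \oo] --> l.
Proof.
move=> n0 nk /cvgrPdist_le sl; apply/cvgrPdist_le => e e0.
have e2 : 0 < e / 2 by rewrite divr_gt0.
near=> k.
have /andP[h1 h2] := @node_idx_itv (n k) (s k) (n0 k).
have h3 : (n k)%:R^-1 <= e / 2.
  rewrite -[e / 2]invrK lef_pV2 ?posrE ?invr_gt0 ?ltr0n//.
  apply: (@le_trans _ _ k%:R); last by rewrite ler_nat.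
  by near: k; exact: nbhs_infty_ger.
have h4 : `|l - s k| <= e / 2.
  by near: k; exact: sl.
rewrite -(subrK (s k) l) -addrA (le_trans (ler_normD _ _))//.
rewrite [leRHS](splitr e) lerD// ger0_norm ?subr_ge0//.
by apply: le_trans h3; rewrite lerBlDr addrC ltW.
Unshelve. all: by end_near. Qed.

(** The range of summation covers [[-k, k)], so every [y] is eventually inside, and the bound at the
    nodes supplies the dominating function. *)
Lemma riemann_sum_cvg (n N : nat -> nat) (c : nat -> int) (u : nat -> int -> R)
    (phi : R -> R) (K a : R) : 0 <= K -> 0 < a ->
  (forall k, (0 < n k)%N) -> (forall k, (k <= n k)%N) ->
  (forall k, (k * n k)%N%:Z <= c k) ->
  (forall k, (k * n k)%N%:Z <= (N k)%:Z - c k) ->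
  (forall k j, - c k <= j < (N k)%:Z - c k ->
    `|u k j| <= K * expR (- (a * node R (n k) j ^+ 2))) ->
  (forall y, u k (idx (n k) y) @[k --> \oo] --> phi y) ->
  continuous phi ->
  ((n k)%:R^-1 * \sum_(i < N k) u k (i%:Z - c k)) @[k --> \oo] -->
    \int[mu]_(y in [set: R]) phi y.
Proof.
move=> K0 a0 n0 nk kc kN uK uphi phi_cont.
pose h k := step_fun (n k) (N k) (c k) (u k).
(* A point [y] and its node [s] differ by at most 1, so [y ^ 2 <= 2 s ^ 2 + 2]: decay of rate [a] in
   [s] is decay of rate [a / 2] in [y], up to the factor [expR a]. *)
have a2 : 0 < a / 2 by rewrite divr_gt0.
have [gauss_int _] := gaussian_integral a2.
have dom_int : mu.-integrable setT
    (fun y => (K * expR a)%:E * (expR (- (a / 2 * y ^+ 2)))%:E)%E.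
  exact: integrableZl.
have [||||phi_int _] := @dominated_convergence _ _ R mu setT measurableT
    (fun k => EFin \o h k) (EFin \o phi) _ _ _ _ dom_int _.
- by move=> k; apply/measurable_EFinP; have [] := integral_step_fun (N k) (c k) (u k) (n0 k).
- by apply/measurable_EFinP; exact: continuous_measurable_fun.
- apply/aeW => y _; apply: cvg_EFin; first by near=> k.
  apply: cvg_trans (uphi y); apply: near_eq_cvg; near=> k.
  rewrite /= /h step_funE// ifT//.
  have yk : `|y| < k%:R by near: k; exact: nbhs_infty_gtr.
  have n0R : 0 < (n k)%:R :> R by rewrite ltr0n.
  have /andP[y1 y2] : - (k * n k)%N%:Z <= idx (n k) y < (k * n k)%N%:Z.
    move: yk; rewrite ltr_norml => /andP[ky yk].
    rewrite /idx floor_ge_int floor_lt_int mulrNz -[(k * n k)%N%:~R]/((k * n k)%:R).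
    by rewrite !natrM; apply/andP; split; nra.
  by rewrite (le_trans _ y1) ?lerN2// (lt_le_trans y2).
- apply/aeW => y k _; rewrite /= lee_fin /h step_funE//; case: ifPn => [yc|_].
    rewrite (le_trans (uK k _ yc))// -(mulrA K) ler_wpM2l// -expRD ler_expR.
    have /andP[h1 h2] := @node_idx_itv (n k) y (n0 k).
    have h3 : (n k)%:R^-1 <= 1 :> R by rewrite invf_le1 ?ler1n// ltr0n.
    move: (node R _ _) h1 h2 => s h1 h2; have : (y - s) ^+ 2 <= 1.
      by rewrite expr_le1 ?subr_ge0//; lra.
    move=> ys; have : a * (y ^+ 2) <= a * (2 * s ^+ 2 + 2).
      rewrite ler_pM2l//; have := sqr_ge0 (y - 2 * s); nra.
    lra.
  by rewrite normr0 mulr_ge0 ?expR_ge0// mulr_ge0 ?expR_ge0.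
rewrite -[X in _ --> X]fineK; last exact: integrable_fin_num.
move=> /fine_cvg; rewrite /Rintegral; apply: cvg_trans.
apply: near_eq_cvg; near=> k.
by have [_ /= ->] := integral_step_fun (N k) (c k) (u k) (n0 k).
Unshelve. all: by end_near. Qed.

End GaussianIntegral.

(** * Convergence *)

Section Growth.
Set Implicit Arguments.
Unset Strict Implicit.
Context {R : realType}.
Local Notation C := R[i].

Lemma normc_lt (z : C) (e : R) : `|z| < e%:C -> normc z < e.
Proof. by rewrite -ltcR. Qed.

Lemma ReB (z w : C) : complex.Re (z - w) = complex.Re z - complex.Re w.
Proof. by case: z w => [a b] [c d]. Qed.

Lemma ImB (z w : C) : complex.Im (z - w) = complex.Im z - complex.Im w.
Proof. by case: z w => [a b] [c d]. Qed.

Lemma norm_Re_le (z : C) : `|complex.Re z| <= normc z.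
Proof.
by case: z => x y /=; rewrite -sqrtr_sqr ler_sqrt ?addr_ge0 ?sqr_ge0// lerDl sqr_ge0.
Qed.

Lemma norm_Im_le (z : C) : `|complex.Im z| <= normc z.
Proof.
by case: z => x y /=; rewrite -sqrtr_sqr ler_sqrt ?addr_ge0 ?sqr_ge0// lerDr sqr_ge0.
Qed.

Lemma continuous_Re (g : R -> C) : continuous (g : R -> C^o) ->
  continuous (fun y => complex.Re (g y)).
Proof.
move=> g_cont y; apply/cvgrPdist_lt => e e0.
have e0C : 0 < e%:C by rewrite ltcR.
have := g_cont y => /cvgrPdist_lt /(_ _ e0C); apply: filterS => s /normc_lt.
by apply: le_lt_trans; rewrite -ReB norm_Re_le.
Qed.

Lemma continuous_Im (g : R -> C) : continuous (g : R -> C^o) ->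
  continuous (fun y => complex.Im (g y)).
Proof.
move=> g_cont y; apply/cvgrPdist_lt => e e0.
have e0C : 0 < e%:C by rewrite ltcR.
have := g_cont y => /cvgrPdist_lt /(_ _ e0C); apply: filterS => s /normc_lt.
by apply: le_lt_trans; rewrite -ImB norm_Im_le.
Qed.

(** [|Re g| + |Im g|] is a continuous real function above the modulus, to which the extreme value
    theorem applies. *)
Lemma bounded_on_segment (g : R -> C) (r : R) : continuous (g : R -> C^o) ->
  exists2 K, 0 <= K & forall y, `|y| <= r -> normc (g y) <= K.
Proof.
move=> g_cont; pose h y := `|complex.Re (g y)| + `|complex.Im (g y)|.
have h0 y : 0 <= h y by rewrite addr_ge0.
have [r0|r0] := leP 0 r; last first.
  by exists 0 => // y /(le_trans (normr_ge0 y)); rewrite leNgt r0.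
have h_cont : continuous h.
  move=> y; apply: cvgD; apply: cvg_norm; first exact: continuous_Re.
  exact: continuous_Im.
have [||s _ sM] := @EVT_max R h (- r) r.
- by rewrite (le_trans _ r0)// oppr_le0.
- exact: continuous_subspaceT.
exists (h s) => // y yr; rewrite (le_trans (normc_le _))// sM//.
by rewrite in_itv/= -ler_norml.
Qed.

(* [rho] may be negative, so near the origin the bound has to come from
   continuity. *)
Lemma subgaussian_bound (g : R -> C) (A B rho a : R) :
  continuous (g : R -> C^o) ->
  (forall x : R, `|g x| <= (A * expR (B * `|x| `^ rho))%:C) -> rho < 2 ->
  0 < a ->
  exists2 K, 0 <= K & forall y, normc (g y) <= K * expR (a * y ^+ 2).
Proof.
move=> g_cont gAB rho2 a0.
have gAB' y : normc (g y) <= `|A| * expR (`|B| * `|y| `^ rho).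
  have : normc (g y) <= A * expR (B * `|y| `^ rho) by rewrite -lecR; exact: gAB.
  move/le_trans; apply; rewrite (le_trans (ler_wpM2r _ (ler_norm A))) ?expR_ge0//.
  by rewrite ler_wpM2l// ler_expR ler_wpM2r ?powR_ge0// ler_norm.
have d0 : 0 < 2 - rho by rewrite subr_gt0.
(* Beyond this radius [|B| <= a |y| ^ (2 - rho)], that is, [|B| |y| ^ rho <= a y ^ 2]. The added 1
   keeps [y] away from 0, where powers do not add up. *)
pose r := 1 + (`|B| / a) `^ (2 - rho)^-1.
have r1 : 1 <= r by rewrite lerDl powR_ge0.
have [K0 K00 gK0] := bounded_on_segment r g_cont.
exists (K0 + `|A|) => [|y]; first by rewrite addr_ge0.
have e1 : 1 <= expR (a * y ^+ 2).
  by rewrite -[leLHS]expR0 ler_expR mulr_ge0 ?sqr_ge0// ltW.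
have [yr|ry] := leP `|y| r.
  rewrite (le_trans (gK0 _ yr))// mulrDl ler_wpDr ?mulr_ge0 ?expR_ge0//.
  by rewrite ler_peMr.
rewrite (le_trans (gAB' y))// mulrDl ler_wpDl ?mulr_ge0 ?expR_ge0//.
rewrite ler_wpM2l// ler_expR.
have y0 : 0 < `|y| by apply: lt_le_trans (ltW ry); apply: lt_le_trans r1.
have -> : y ^+ 2 = `|y| `^ (2 - rho) * `|y| `^ rho.
  rewrite -powRD; last by rewrite (gt_eqF y0) implybT.
  by rewrite subrK powR_mulrn// real_normK// num_real.
rewrite mulrA ler_wpM2r ?powR_ge0// -ler_pdivrMl// mulrC.
have -> : `|B| / a = ((`|B| / a) `^ (2 - rho)^-1) `^ (2 - rho).
  by rewrite -powRrM mulVf ?gt_eqF// powRr1// divr_ge0// ltW.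
rewrite ge0_ler_powR ?nnegrE ?powR_ge0//; first exact: ltW.
by apply: le_trans (ltW ry); rewrite lerDr.
Qed.

End Growth.

(** * Error of the Gaussian approximation, summed against the datum *)

Section Approximation.
Set Implicit Arguments.
Unset Strict Implicit.
Context {R : realType}.
Local Notation C := R[i].

Lemma grid_sum_supp (n L : nat) (v : int -> C) : L%:Z < n%:Z ^+ 2 ->
  (forall l, ~~ (- L%:Z <= l <= L%:Z) -> v l = 0) ->
  grid_sum n v = sym_sum L v.
Proof.
move=> Ln v0; have n2 : 2 != 0 :> C by rewrite pnatr_eq0.
(* The factor 2 cancels the weight one half built into [grid_sum_sym]. *)
rewrite -[RHS](mulVKf n2) -(@grid_sum_sym _ n)// -grid_sumZ; apply: eq_grid_sum => l _.
case: ifPn => [_|/v0 ->]; last by rewrite !mulr0.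
by rewrite mulrA divff ?mul1r.
Qed.

Lemma sym_sumZ (L : nat) (c : C) (u : int -> C) :
  sym_sum L (fun l => c * u l) = c * sym_sum L u.
Proof. by rewrite /sym_sum mulr_sumr. Qed.

(* [grid_conv_kernel] with [heat_kernel] replaced by its Gaussian limit. *)
Definition gauss_conv (n m M : nat) (g : R -> C) (t x : R) : C :=
  (gauss_sum n M (node R n (idx n t)) 0)%:C * (n%:R^-1 * sym_sum (m * n)
    (fun l => truncate m g (node R n l) * (expR (- ((node R n (idx n x) -
      node R n l) ^+ 2 / (4 * node R n (idx n t)))))%:C)).

Definition amp_cst : R := 8 * pi ^+ 3 + pi ^+ 4.

Definition ode_cst (T : R) : R := pi ^+ 2 + 2 * (pi ^+ 2 * T) +
  8 * pi * (pi ^+ 2 * T) + 16 * (pi ^+ 2 * T) ^+ 2.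

(** The first summand comes from [heat_kernel_gauss_sum_le], the second from [gauss_sum_ode_le], for
    discrete times between [t0 / 2] and [t0 + 1]. *)
Definition approx_cst (t0 : R) : R := 3 * amp_cst * (t0 + 1) +
  (2 * pi * t0)^-1 * (2 + 3 * ode_cst (t0 + 1)).

Lemma amp_cst_ge0 : 0 <= amp_cst.
Proof. by rewrite addr_ge0 ?mulr_ge0 ?exprn_ge0 ?pi_ge0. Qed.

Lemma ode_cst_ge0 (T : R) : 0 <= T -> 0 <= ode_cst T.
Proof.
move=> T0; have p := @pi_ge0 R; rewrite /ode_cst.
by do ![exact: sqr_ge0 | by [] | apply: addr_ge0 | apply: mulr_ge0].
Qed.

Lemma ler_ode_cst (S T : R) : 0 <= S -> S <= T -> ode_cst S <= ode_cst T.
Proof.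
move=> S0 ST; have p := @pi_ge0 R.
have pST : pi ^+ 2 * S <= pi ^+ 2 * T by rewrite ler_wpM2l ?sqr_ge0.
have pS0 : 0 <= pi ^+ 2 * S by rewrite mulr_ge0 ?sqr_ge0.
have h : (pi ^+ 2 * S) ^+ 2 <= (pi ^+ 2 * T) ^+ 2.
  by rewrite lerXn2r ?nnegrE// (le_trans pS0).
have h' : pi * (pi ^+ 2 * S) <= pi * (pi ^+ 2 * T) by rewrite ler_wpM2l.
by rewrite /ode_cst -(mulrA 8) -(mulrA 8); lra.
Qed.

(** The two conditions on [c] let [exp (- c M ^ 2)] dominate both [1 / n] and the tail
    [exp (- pi ^ 2 tau M ^ 2)]. Powers of [M] up to the fifth go into [exp (M) ^ 5]. *)
Lemma kernel_approx_le (n M i : nat) (d : int) (t0 c : R) :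
  0 < t0 -> 0 < c -> c <= 1 -> c <= pi ^+ 2 * t0 / 2 ->
  (5 <= M)%N -> 2 * (amp_cst * (t0 + 1)) <= M%:R ->
  expR (M%:R ^+ 2) <= n%:R :> R -> t0 / 2 <= i%:R / n%:R <= t0 + 1 ->
  `|node R n d| <= M%:R ->
  normc (heat_kernel n M i d - (gauss_sum n M (i%:R / n%:R) 0 *
    expR (- (node R n d ^+ 2 / (4 * (i%:R / n%:R)))))%:C) <=
  approx_cst t0 * expR M%:R ^+ 5 * expR (- (c * M%:R ^+ 2)).
Proof.
move=> t00 c0 c1 ct M5 MT Mn /andP[t1 t2] dM.
have p0 := @pi_gt0 R; have a0 := amp_cst_ge0.
have M5R : 5 <= M%:R :> R by rewrite ler_nat.
have nM : 1 + M%:R ^+ 2 <= n%:R :> R by apply: le_trans Mn; exact: expR_ge1Dx.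
have n0R : 0 < n%:R :> R by apply: lt_le_trans Mn; exact: expR_gt0.
have n0 : (0 < n)%N by rewrite ltr0n in n0R.
have MnR : M%:R < n%:R :> R by nra.
have piM : pi * M%:R <= n%:R :> R.
  have pi4 : pi <= 4 :> R by have := @pihalf_lt2 R; lra.
  by nra.
set tau := i%:R / n%:R in t1 t2 *; have tau0 : 0 < tau by lra.
pose X := expR M%:R : R; pose W := expR (- (c * M%:R ^+ 2)).
have MX : M%:R <= X by rewrite /X; have := expR_ge1Dx (M%:R : R); lra.
have MjX j : M%:R ^+ j <= X ^+ j by rewrite lerXn2r ?nnegrE ?expR_ge0.
have X1 : 1 <= X by lra.
have X5 j : (j <= 5)%N -> M%:R ^+ j <= X ^+ 5.
  by move=> j5; rewrite (le_trans (MjX j))// ler_eXn2l//; lra.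
have W0 : 0 <= W by exact: expR_ge0.
have nV : n%:R^-1 <= expR (- M%:R ^+ 2) :> R.
  by rewrite expRN lef_pV2 ?posrE ?expR_gt0.
have nW : n%:R^-1 <= W.
  rewrite (le_trans nV)// ler_expR lerN2 ler_piMl// sqr_ge0.
have taW : expR (- (pi ^+ 2 * tau * M%:R ^+ 2)) <= W.
  rewrite ler_expR lerN2 ler_wpM2r ?sqr_ge0// (le_trans ct)// -mulrA.
  by rewrite ler_wpM2l ?sqr_ge0.
pose e := amp_cst * (t0 + 1) * M%:R ^+ 4 * n%:R^-1.
have ie : i%:R * (amp_cst * M%:R ^+ 4 / n%:R ^+ 2) <= e.
  have -> : i%:R * (amp_cst * M%:R ^+ 4 / n%:R ^+ 2) =
      (amp_cst * tau * M%:R ^+ 4) * n%:R^-1.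
    by rewrite /tau; field; rewrite gt_eqF.
  rewrite ler_wpM2r ?invr_ge0 ?(ltW n0R)// ler_wpM2r ?exprn_ge0//.
  by rewrite ler_wpM2l.
(* [5 <= M] gives [4 M - M ^ 2 <= - M], so [M ^ 4 / n <= exp (- M) <= 1 / M]; the premise on
   [amp_cst] does the rest. *)
have e2 : e <= 2^-1.
  have h1 : M%:R ^+ 4 * n%:R^-1 <= expR (- M%:R) :> R.
    apply: (@le_trans _ _ (X ^+ 4 * expR (- M%:R ^+ 2))).
      by rewrite ler_pM ?exprn_ge0 ?invr_ge0 ?(ltW n0R).
    by rewrite -expRM_natl -expRD ler_expR; nra.
  have h2 : expR (- M%:R) <= M%:R^-1 :> R.
    by rewrite expRN lef_pV2 ?posrE ?expR_gt0//; lra.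
  have M0 : 0 < M%:R :> R by lra.
  rewrite /e -mulrA (le_trans (ler_wpM2l _ (le_trans h1 h2)))//.
    by rewrite mulr_ge0//; lra.
  by rewrite ler_pdivrMr//; lra.
have M0 : (0 < M)%N by apply: leq_trans M5.
have Mn0 : (0 < M < n)%N by rewrite M0 -(ltr_nat R).
have h1 := @heat_kernel_gauss_sum_le R n M i d e Mn0 piM ie e2.
have h2 := gauss_sum_ode_le n0 M0 tau0 dM.
set G := gauss_sum n M tau (node R n d) in h1 h2.
set Q := gauss_sum n M tau 0 * _ in h2 *.
have -> : heat_kernel n M i d - Q%:C = (heat_kernel n M i d - G%:C) + (G - Q)%:C.
  by rewrite rmorphB/=; ring.
rewrite (le_trans (le_normcD _ _))// normc_real (le_trans (lerD h1 h2))//.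
rewrite -/(ode_cst tau) -/X -/W /approx_cst -[leRHS]mulrA [leRHS]mulrDl lerD//.
  apply: (@le_trans _ _ (3 * M%:R * (amp_cst * (t0 + 1) * M%:R ^+ 4 * W))).
    have at0 : 0 <= amp_cst * (t0 + 1) * M%:R ^+ 4.
      by rewrite !mulr_ge0 ?exprn_ge0//; lra.
    apply: ler_pM; [lra| |lra|]; first by rewrite mulr_ge0 ?invr_ge0 ?(ltW n0R).
    by rewrite ler_wpM2l.
  have -> : 3 * M%:R * (amp_cst * (t0 + 1) * M%:R ^+ 4 * W) =
      3 * amp_cst * (t0 + 1) * M%:R ^+ 5 * W by ring.
  by rewrite [leRHS]mulrA ler_wpM2r// ler_wpM2l ?X5// !mulr_ge0//; lra.
have o1 : ode_cst tau <= ode_cst (t0 + 1) by rewrite ler_ode_cst// ltW.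
have o0 : 0 <= ode_cst tau by rewrite ode_cst_ge0// ltW.
have tV : (4 * pi * tau)^-1 <= (2 * pi * t0)^-1.
  have -> : 2 * pi * t0 = 4 * pi * (t0 / 2) by field.
  have p4 : 0 < 4 * pi :> R by rewrite mulr_gt0.
  rewrite lef_pV2 ?posrE; [by rewrite ler_pM2l| |].
    exact: mulr_gt0.
  by rewrite mulr_gt0// divr_gt0.
have -> : M%:R / (4 * pi * tau) * (2 * expR (- (pi ^+ 2 * tau * M%:R ^+ 2)) +
    3 * ode_cst tau * M%:R ^+ 3 / n%:R) =
  (4 * pi * tau)^-1 * (2 * M%:R * expR (- (pi ^+ 2 * tau * M%:R ^+ 2)) +
    3 * ode_cst tau * M%:R ^+ 4 / n%:R) by ring.
rewrite -[leRHS]mulrA ler_pM//.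
- by rewrite invr_ge0 !mulr_ge0// ltW.
- by rewrite addr_ge0// ?mulr_ge0 ?expR_ge0 ?exprn_ge0 ?invr_ge0 ?(ltW n0R).
rewrite [leRHS]mulrDl lerD//.
  rewrite -[leLHS]mulrA ler_wpM2l// ler_pM ?expR_ge0//.
  by rewrite -[leLHS]expr1 X5.
rewrite -[leLHS]mulrA ler_pM ?mulr_ge0 ?exprn_ge0 ?invr_ge0 ?(ltW n0R)//.
  by rewrite ler_wpM2l.
by rewrite ler_pM ?exprn_ge0 ?invr_ge0 ?(ltW n0R)// X5.
Qed.

(** Two more powers of [exp M] than for the kernel: one bounds the datum, by [exp (m ^ 2) <= exp M],
    the other the length of the summation interval, by [3 M]. *)
Lemma grid_conv_gauss_conv_le (n m M : nat) (g : R -> C) (f : R -> R -> C)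
    (t x t0 c K : R) :
  0 < t0 -> 0 < c -> c <= 1 -> c <= pi ^+ 2 * t0 / 2 ->
  0 <= K -> (forall y, normc (g y) <= K * expR (y ^+ 2)) ->
  (5 <= M)%N -> 2 * (amp_cst * (t0 + 1)) <= M%:R ->
  expR (M%:R ^+ 2) <= n%:R :> R -> m%:R ^+ 2 <= M%:R :> R -> (0 < m)%N ->
  t0 / 2 <= node R n (idx n t) <= t0 + 1 ->
  `|node R n (idx n x)| + m%:R <= M%:R -> (m + 2 <= n)%N ->
  grid_time n t -> 2 * idx n t < (n * (n - m))%N%:Z - 2 ->
  discrete_heat_solution n (truncate m (meas_ext n g)) f ->
  normc (grid_conv n (inv_transform n (@cutoff R n M)) f t x -
    gauss_conv n m M g t x) <=
  3 * K * approx_cst t0 * expR M%:R ^+ 7 * expR (- (c * M%:R ^+ 2)).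
Proof.
move=> t00 c0 c1 ct K0 gK M5 MT Mn mM m0 tt xM mn t_time tn f_sol.
have n0 : (0 < n)%N by apply: leq_trans mn; rewrite addn2.
have n0R : 0 < n%:R :> R by rewrite ltr0n.
rewrite (grid_conv_kernel M x mn f_sol t_time tn).
set i := `|idx n t|%N; set j := idx n x.
have iE : i%:R / n%:R = node R n (idx n t).
  have idx0 : 0 <= idx n t.
    by rewrite /idx floor_ge0 mulr_ge0//; move: t_time => /andP[].
  by rewrite /node -[in RHS](gez0_abs idx0).
have mmn : (m * n)%N%:Z < n%:Z ^+ 2.
  by rewrite expr2 -PoszM ltz_nat ltn_mul2r n0; apply: leq_trans mn; rewrite addn2 ltnS.
have trunc0 l : ~~ (- (m * n)%N%:Z <= l <= (m * n)%N%:Z) ->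
    truncate m g (node R n l) = 0.
  move=> lm; rewrite /truncate ifF//; apply: contraNF lm => /andP[l1 l2].
  move: l1 l2; rewrite /node ler_pdivlMr// ltr_pdivrMr// mulNr -natrM.
  rewrite -[(m * n)%:R]/((m * n)%N%:~R) -mulrNz ler_int ltr_int => -> /ltW.
  exact.
rewrite (@grid_sum_supp n (m * n))//; last by move=> l /trunc0 ->; rewrite mul0r.
rewrite /gauss_conv -/j -iE.
set S0 := gauss_sum _ _ _ 0.
pose E := approx_cst t0 * expR M%:R ^+ 5 * expR (- (c * M%:R ^+ 2)).
rewrite mulrCA -mulrBr -sym_sumZ -sym_sumB normcM normcV normc_nat.
have M5R : 5 <= M%:R :> R by rewrite ler_nat.
have m1R : 1 <= m%:R :> R by rewrite ler1n.
have mMR : m%:R <= M%:R :> R by apply: le_trans mM; rewrite expr2 ler_peMl//; lra.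
have MX : M%:R <= expR M%:R :> R by have := expR_ge1Dx (M%:R : R); lra.
have E0 : 0 <= E.
  rewrite !mulr_ge0 ?exprn_ge0 ?expR_ge0// addr_ge0//.
    by rewrite !mulr_ge0 ?amp_cst_ge0//; lra.
  have p0 := @pi_ge0 R; have T0 : 0 <= t0 + 1 by lra.
  have o0 := ode_cst_ge0 T0; rewrite mulr_ge0 ?invr_ge0 ?mulr_ge0 ?(ltW t00)//.
  by rewrite addr_ge0// mulr_ge0.
apply: (@le_trans _ _ (n%:R^-1 * sym_sum (m * n) (fun=> K * expR M%:R * E))).
  rewrite ler_wpM2l ?invr_ge0 ?(ltW n0R)// (le_trans (normc_sym_sum _ _))//.
  apply: ler_sym_sum => l lm; rewrite [S0%:C * _]mulrCA -mulrBr normcM.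
  have lmR := @norm_node_le R n m l n0 lm.
  apply: ler_pM; rewrite ?normc_ge0//.
    rewrite /truncate; case: ifPn => _; last first.
      by rewrite normc0 mulr_ge0 ?expR_ge0.
    rewrite (le_trans (gK _))// ler_wpM2l// ler_expR (le_trans _ mM)//.
    rewrite -(real_normK (num_real (node R n l))).
    by rewrite lerXn2r ?nnegrE.
  have djl : node R n j - node R n l = node R n (j - l).
    by rewrite /node intrB mulrBl.
  rewrite djl -rmorphM/=; apply: kernel_approx_le => //; first by rewrite iE.
  rewrite -djl (le_trans (ler_normB _ _))// (le_trans _ xM)//.
  by rewrite lerD2l.
rewrite sym_sum_cst.
have -> : 3 * K * approx_cst t0 * expR M%:R ^+ 7 * expR (- (c * M%:R ^+ 2)) =
  (3 * expR M%:R) * (K * expR M%:R * E) by rewrite /E; ring.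
have KX0 : 0 <= K * expR M%:R by rewrite mulr_ge0 ?expR_ge0.
rewrite [leLHS]mulrA (ler_wpM2r (mulr_ge0 KX0 E0))//.
rewrite mulrC ler_pdivrMr// natrD !natrM.
have n1R : 1 <= n%:R :> R by rewrite ler1n.
apply: (@le_trans _ _ (3 * M%:R * n%:R)); first by nra.
by rewrite ler_wpM2r ?(ltW n0R)// ler_wpM2l.
Qed.

End Approximation.

(** * Limits of the normalizing factor and of the Riemann sum *)

Section GaussConvLimit.
Set Implicit Arguments.
Unset Strict Implicit.
Context {R : realType}.
Local Notation C := R[i].
Context (n m M : nat -> nat) (tau X : nat -> R) (t0 x0 : R).
Context (n0 : forall k, (0 < n k)%N) (nk : forall k, (k <= n k)%N).
Context (mk : forall k, (k <= m k)%N) (Mk : forall k, (k <= M k)%N).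
Context (t00 : 0 < t0) (tauP : forall k, t0 / 2 <= tau k <= t0 + 1).
Context (tau_cvg : tau @ \oo --> t0) (X_cvg : X @ \oo --> x0).

(** Half the integral of [exp (- pi ^ 2 t0 y ^ 2)]: this is the origin of the normalization of the
    heat kernel. *)
Lemma gauss_sum0_cvg :
  gauss_sum (n k) (M k) (tau k) 0 @[k --> \oo] --> (Num.sqrt (4 * pi * t0))^-1.
Proof.
have p0 := @pi_gt0 R.
pose b := pi ^+ 2 * t0; have b0 : 0 < b by rewrite mulr_gt0// exprn_gt0.
have [_ gint] := gaussian_integral b0.
have -> : (Num.sqrt (4 * pi * t0))^-1 =
    2^-1 * \int[lebesgue_measure]_(y in [set: R]) expR (- (b * y ^+ 2)).
  have -> : 4 * pi * t0 = 2 ^+ 2 * (pi * t0) by ring.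
  rewrite gint sqrtrM ?sqr_ge0// sqrtr_sqr ger0_norm// invfM; congr (_ * _).
  have -> : pi / b = (pi * t0)^-1.
    by rewrite /b; move: pi p0 => p p0; field; rewrite !gt_eqF.
  by rewrite sqrtrV// mulr_ge0// ltW.
pose u k (l : int) := expR (- (pi ^+ 2 * tau k * node R (n k) l ^+ 2)).
have -> : (fun k => gauss_sum (n k) (M k) (tau k) 0) = (fun k => 2^-1 *
    ((n k)%:R^-1 * \sum_(i < (2 * (M k * n k)).+1) u k (i%:Z - (M k * n k)%N%:Z))).
  apply/funext => k; rewrite /gauss_sum invfM -mulrA; congr (_ * (_ * _)).
  by apply: eq_bigr => i _; rewrite mulr0 cos0 mul1r.
apply: cvgM; first exact: cvg_cst.
apply: (@riemann_sum_cvg R n _ _ u (fun y => expR (- (b * y ^+ 2))) 1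
  (pi ^+ 2 * (t0 / 2))) => //.
- by rewrite mulr_gt0 ?exprn_gt0// divr_gt0.
- by move=> k; rewrite lez_nat leq_mul2r Mk orbT.
- move=> k; have := leq_mul (Mk k) (leqnn (n k)).
  by move: (M k * n k)%N (k * n k)%N => a c; lia.
- move=> k j _; have /andP[t1 t2] := tauP k; rewrite /u mul1r ger0_norm ?expR_ge0//.
  by rewrite ler_expR lerN2 ler_wpM2r ?sqr_ge0// ler_wpM2l ?sqr_ge0.
- move=> y; rewrite /u; apply: continuous_cvg; first exact: continuous_expR.
  apply: cvgN; apply: cvgM; first by apply: cvgM => //; exact: cvg_cst.
  by rewrite expr2; under eq_fun do rewrite expr2; apply: cvgM; apply: cvg_node_idx => //; exact: cvg_cst.
- move=> y; apply: continuous_comp; last exact: continuous_expR.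
  apply: continuousN; apply: continuousM; first exact: cst_continuous.
  exact: exprn_continuous.
Qed.

(** The growth rate allowed for [phi] is a quarter of the decay rate [1 / (4 (t0 + 1))] of the
    flattest kernel, so Gaussian decay survives. *)
Lemma heat_riemann_cvg (phi : R -> R) (K : R) : continuous phi -> 0 <= K ->
  (forall y, `|phi y| <= K * expR ((16 * (t0 + 1))^-1 * y ^+ 2)) ->
  (n k)%:R^-1 * sym_sum (m k * n k) (fun l =>
    (if - (m k)%:R <= node R (n k) l < (m k)%:R then phi (node R (n k) l) else 0)
    * expR (- ((X k - node R (n k) l) ^+ 2 / (4 * tau k)))) @[k --> \oo] -->
  \int[lebesgue_measure]_(y in [set: R])
    (expR (- (x0 - y) ^+ 2 / (4 * t0)) * phi y).
Proof.
move=> phi_cont K0 phiK; set T := t0 + 1 in phiK; set a := (16 * T)^-1 in phiK.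
have T0 : 0 < T by rewrite addr_gt0.
have a0 : 0 < a by rewrite invr_gt0 mulr_gt0.
have [B XB] : exists B, forall k, `|X k| <= B.
  have /cvg_seq_bounded [B [_ XB]] : cvg (X @ \oo) by apply/cvg_ex; exists x0.
  by exists (B + 1) => k; apply: XB => //; rewrite ltrDl.
have B0 : 0 <= B by apply: le_trans (XB 0%N).
pose u k (l : int) := (if - (m k)%:R <= node R (n k) l < (m k)%:R
    then phi (node R (n k) l) else 0)
    * expR (- ((X k - node R (n k) l) ^+ 2 / (4 * tau k))).
apply: (@riemann_sum_cvg R n _ _ u _ (K * expR (B ^+ 2 / (4 * T))) a) => //.
- by rewrite mulr_ge0// expR_ge0.
- by move=> k; rewrite lez_nat leq_mul2r mk orbT.
- move=> k; have := leq_mul (mk k) (leqnn (n k)).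
  by move: (m k * n k)%N (k * n k)%N => p q; lia.
- move=> k j _; rewrite /u; move: (node R (n k) j) => y.
  have /andP[t1 t2] := tauP k; have tk0 : 0 < tau k by apply: lt_le_trans t1; rewrite divr_gt0.
  apply: (@le_trans _ _ (K * expR (a * y ^+ 2) *
      expR (- ((X k - y) ^+ 2 / (4 * T))))).
    rewrite normrM; apply: ler_pM => //.
      case: ifP => _; first exact: phiK.
      by rewrite normr0 mulr_ge0 ?expR_ge0.
    rewrite ger0_norm ?expR_ge0// ler_expR lerN2 ler_wpM2l ?sqr_ge0//.
    by rewrite lef_pV2 ?posrE ?mulr_gt0// ler_pM2l.
  rewrite -(mulrA K) -(mulrA K) (ler_wpM2l K0)// -!expRD ler_expR.
  have -> : a = (4 * T)^-1 * 4^-1 by rewrite /a; field; rewrite gt_eqF.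
  have XBk : X k ^+ 2 <= B ^+ 2.
    by rewrite -(real_normK (num_real (X k))) lerXn2r ?nnegrE.
  have T4 : 0 <= (4 * T)^-1 by rewrite invr_ge0 mulr_ge0// ltW.
  rewrite -subr_ge0.
  (* [2 * a] is half the kernel's rate; by completing the square, the shift [X k] costs at most
     [B ^ 2 / (4 * T)]. *)
  have -> : B ^+ 2 / (4 * T) - (4 * T)^-1 * 4^-1 * y ^+ 2 -
    ((4 * T)^-1 * 4^-1 * y ^+ 2 - (X k - y) ^+ 2 / (4 * T)) =
    (4 * T)^-1 * (B ^+ 2 - X k ^+ 2 + 2 * (X k - 2^-1 * y) ^+ 2).
    by field; rewrite gt_eqF.
  by rewrite mulr_ge0// addr_ge0 ?subr_ge0// mulr_ge0// sqr_ge0.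
- move=> y; rewrite /u mulrC.
  set s := fun k => node R (n k) (idx (n k) y).
  have s_cvg : s k @[k --> \oo] --> y by apply: cvg_node_idx => //; exact: cvg_cst.
  apply: cvgM.
    have phis : phi (s k) @[k --> \oo] --> phi y by apply: continuous_cvg => //; exact: phi_cont.
    apply: cvg_trans phis; apply: near_eq_cvg; near=> k.
    rewrite /s ifT//.
    (* At a fixed [y] the truncation is eventually inactive; the 1 allows for rounding to the
       node. *)
    have mk1 : `|y| + 1 < (m k)%:R.
      apply: (@lt_le_trans _ _ k%:R); last by rewrite ler_nat.
      by near: k; exact: nbhs_infty_gtr.
    have /andP[h1 h2] := @node_idx_itv R (n k) y (n0 k).
    have h3 : (n k)%:R^-1 <= 1 :> R by rewrite invf_le1 ?ler1n// ltr0n.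
    move: mk1; rewrite -ltrBrDr ltr_norml => /andP[m1 m2].
    by apply/andP; split; lra.
  apply: continuous_cvg; first exact: continuous_expR.
  rewrite mulNr; apply: cvgN; apply: cvgM.
    rewrite expr2; under eq_fun do rewrite expr2.
    by apply: cvgM; apply: cvgB.
  apply: cvgV; first by rewrite mulf_neq0// gt_eqF.
  by apply: cvgM => //; exact: cvg_cst.
- move=> y; apply: cvgM; last exact: phi_cont.
  apply: continuous_cvg; first exact: continuous_expR.
  apply: cvgM; last exact: cvg_cst.
  apply: cvgN; rewrite expr2; under eq_fun do rewrite expr2.
  by apply: cvgM; apply: cvgB; (exact: cvg_cst || exact: cvg_id).
Unshelve. all: by end_near. Qed.

End GaussConvLimit.

(** * Real and imaginary parts of the approximation and of the classical solution *)

Section ReIm.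
Set Implicit Arguments.
Unset Strict Implicit.
Context {R : realType}.
Local Notation C := R[i].

Lemma ReZ (r : R) (z : C) : complex.Re (r%:C * z) = r * complex.Re z.
Proof. by case: z => x y; rewrite /= mul0r subr0. Qed.

Lemma ImZ (r : R) (z : C) : complex.Im (r%:C * z) = r * complex.Im z.
Proof. by case: z => x y; rewrite /= mul0r addr0. Qed.

Lemma Re_sym_sum (L : nat) (u : int -> C) :
  complex.Re (sym_sum L u) = sym_sum L (fun l => complex.Re (u l)).
Proof.
by rewrite /sym_sum (big_morph (@complex.Re R) (id1 := 0) (op1 := +%R))// => -[? ?] [].
Qed.

Lemma Im_sym_sum (L : nat) (u : int -> C) :
  complex.Im (sym_sum L u) = sym_sum L (fun l => complex.Im (u l)).
Proof.
by rewrite /sym_sum (big_morph (@complex.Im R) (id1 := 0) (op1 := +%R))// => -[? ?] [].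
Qed.

Lemma Re_gauss_conv (n m M : nat) (g : R -> C) (t x : R) :
  complex.Re (gauss_conv n m M g t x) =
  gauss_sum n M (node R n (idx n t)) 0 * (n%:R^-1 * sym_sum (m * n) (fun l =>
    (if - m%:R <= node R n l < m%:R then complex.Re (g (node R n l)) else 0) *
    expR (- ((node R n (idx n x) - node R n l) ^+ 2 /
      (4 * node R n (idx n t)))))).
Proof.
rewrite /gauss_conv ReZ -(rmorph_nat (real_complex R)) -fmorphV ReZ Re_sym_sum.
congr (_ * (_ * _)); apply: eq_sym_sum => l _; rewrite mulrC ReZ mulrC.
by congr (_ * _); rewrite /truncate; case: ifP.
Qed.

Lemma Im_gauss_conv (n m M : nat) (g : R -> C) (t x : R) :
  complex.Im (gauss_conv n m M g t x) =
  gauss_sum n M (node R n (idx n t)) 0 * (n%:R^-1 * sym_sum (m * n) (fun l =>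
    (if - m%:R <= node R n l < m%:R then complex.Im (g (node R n l)) else 0) *
    expR (- ((node R n (idx n x) - node R n l) ^+ 2 /
      (4 * node R n (idx n t)))))).
Proof.
rewrite /gauss_conv ImZ -(rmorph_nat (real_complex R)) -fmorphV ImZ Im_sym_sum.
congr (_ * (_ * _)); apply: eq_sym_sum => l _; rewrite mulrC ImZ mulrC.
by congr (_ * _); rewrite /truncate; case: ifP.
Qed.

Lemma Re_classical_heat (g : R -> C) (t x : R) : 0 < t ->
  complex.Re (classical_heat g t x) = (Num.sqrt (4 * pi * t))^-1 *
  \int[lebesgue_measure]_(y in [set: R])
    (expR (- (x - y) ^+ 2 / (4 * t)) * complex.Re (g y)).
Proof.
move=> t0; rewrite /classical_heat gt_eqF// ReZ; congr (_ * _).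
by rewrite /=; apply: eq_Rintegral => y _; rewrite ReZ.
Qed.

Lemma Im_classical_heat (g : R -> C) (t x : R) : 0 < t ->
  complex.Im (classical_heat g t x) = (Num.sqrt (4 * pi * t))^-1 *
  \int[lebesgue_measure]_(y in [set: R])
    (expR (- (x - y) ^+ 2 / (4 * t)) * complex.Im (g y)).
Proof.
move=> t0; rewrite /classical_heat gt_eqF// ImZ; congr (_ * _).
by rewrite /=; apply: eq_Rintegral => y _; rewrite ImZ.
Qed.

End ReIm.

Lemma near_seq_cvg (R : realType) (s : nat -> R) (l : R) :
  (forall k, `|s k - l| < k.+1%:R^-1) -> s @ \oo --> l.
Proof.
move=> sl; apply/cvgrPdist_le => e e0; near=> k.
rewrite distrC (le_trans (ltW (sl k)))// -[e]invrK lef_pV2 ?posrE ?invr_gt0//.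
apply: (@le_trans _ _ k%:R); last by rewrite ler_nat.
by near: k; exact: nbhs_infty_ger.
Unshelve. all: by end_near. Qed.

(** The premises are what transfer yields at each [k], with explicit rates; a single good index
    already contradicts a sequence of counterexamples. *)
Lemma heat_limit (R : realType) (g : R -> R[i]) (A B rho : R)
  (g_cont : continuous (g : R -> R[i]^o))
  (g_bound : forall x : R, `|g x| <= (A * expR (B * `|x| `^ rho))%:C)
  (rho_lt2 : rho < 2) (n m M : nat -> nat) (f : nat -> R -> R -> R[i])
  (t x : nat -> R) (t0 x0 : R) (t0_gt0 : 0 < t0)
  (n_ge : forall k, (k <= n k)%N) (m_ge : forall k, (k <= m k)%N)
  (M_ge : forall k, (k <= M k)%N)
  (nm : forall k, k%:R < (n k)%:R - (m k)%:R :> R)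
  (mM : forall k, (m k)%:R < Num.sqrt (M k)%:R :> R)
  (Mn : forall k, (M k)%:R < Num.sqrt (ln (n k)%:R) :> R)
  (f_sol : forall k,
    discrete_heat_solution (n k) (truncate (m k) (meas_ext (n k) g)) (f k))
  (t_time : forall k, grid_time (n k) (t k))
  (tt0 : forall k, `|t k - t0| < k.+1%:R^-1)
  (xx0 : forall k, `|x k - x0| < k.+1%:R^-1) (e : R[i]) :
  0 < e -> exists k,
    `|grid_conv (n k) (inv_transform (n k) (@cutoff R (n k) (M k))) (f k)
        (t k) (x k) - classical_heat g t0 x0| < e.
Proof.
move=> e0; have [d d0 ->] : exists2 d : R, 0 < d & e = d%:C.
  exists (complex.Re e); first by move: e0; rewrite ltcE => /andP[].
  by move: e0; case: e => a b; rewrite ltcE /= => /andP[/eqP ->].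
have p0 := @pi_gt0 R.
pose T := t0 + 1; have T0 : 0 < T by rewrite addr_gt0.
have a0 : 0 < (16 * T)^-1 by rewrite invr_gt0 mulr_gt0.
(* Two growth bounds are used: this rate is the one [heat_riemann_cvg] accepts, while the rate 1
   below serves the error estimate, where the datum need only be at most a multiple of
   [exp (m ^ 2)]. *)
have [Ka Ka0 gKa] := subgaussian_bound g_cont g_bound rho_lt2 a0.
have [K1 K10 gK1'] := subgaussian_bound g_cont g_bound rho_lt2 (@ltr01 R).
have gK1 y : normc (g y) <= K1 * expR (y ^+ 2) by rewrite -[y ^+ 2]mul1r.
pose c := Num.min 1 (pi ^+ 2 * t0 / 2).
have c0 : 0 < c by rewrite lt_min ltr01 divr_gt0// mulr_gt0// exprn_gt0.
have c1 : c <= 1 by rewrite ge_min lexx.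
have ct : c <= pi ^+ 2 * t0 / 2 by rewrite ge_min lexx orbT.
pose Cst := 3 * K1 * approx_cst t0.
(* Indices are shifted by [k0] so that all estimates hold for every [k]. *)
pose r := 6 + 4 / t0 + 2 * `|amp_cst * T| + (`|x0| + 3) + 2 * T + 8 / c +
  3 * `|Cst| / d.
have [k0 k0r] : exists k0 : nat, r <= k0%:R.
  by exists (Num.truncn r).+1; exact/ltW/truncnS_gt.
have t0V : 0 <= 4 / t0 by rewrite divr_ge0// ltW.
have cV : 0 <= 8 / c by rewrite divr_ge0// ltW.
have CV : 0 <= 3 * `|Cst| / d by rewrite divr_ge0 ?mulr_ge0// ltW.
have ampV := normr_ge0 (amp_cst * T); have x0V := normr_ge0 x0.
(* [kt] bounds the errors in time by [t0 / 4], [kamp] serves [kernel_approx_le], [kx] gives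
   [|X| + m <= 2 m <= m ^ 2 <= M], [kT] keeps the support off the left end, [kc] and [kC] make the
   final error less than [d / 3]. *)
have k6 : 6 <= k0%:R :> R by apply: le_trans k0r; rewrite /r; lra.
have kt : 4 / t0 <= k0%:R by apply: le_trans k0r; rewrite /r; lra.
have kamp : 2 * `|amp_cst * T| <= k0%:R by apply: le_trans k0r; rewrite /r; lra.
have kx : `|x0| + 3 <= k0%:R by apply: le_trans k0r; rewrite /r; lra.
have kT : 2 * T + 6 <= k0%:R by apply: le_trans k0r; rewrite /r; lra.
have kc : 8 / c <= k0%:R by apply: le_trans k0r; rewrite /r; lra.
have kC : 3 * `|Cst| / d + 6 <= k0%:R by apply: le_trans k0r; rewrite /r; lra.
have k00 : 0 < k0%:R :> R by lra.
clear k0r r.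
have le_nat k (h : nat -> nat) : (forall k, (k <= h k)%N) ->
    k0%:R <= (h (k + k0)%N)%:R :> R.
  by move=> hk; rewrite ler_nat (leq_trans _ (hk _))// leq_addl.
have n0 k : (0 < n (k + k0)%N)%N.
  by rewrite -(ltr_nat R); have := le_nat k n n_ge; lra.
have nk k : (k <= n (k + k0))%N by rewrite (leq_trans _ (n_ge _))// leq_addr.
have mk k : (k <= m (k + k0))%N by rewrite (leq_trans _ (m_ge _))// leq_addr.
have Mk k : (k <= M (k + k0))%N by rewrite (leq_trans _ (M_ge _))// leq_addr.
have k1V k : (k + k0).+1%:R^-1 <= k0%:R^-1 :> R.
  rewrite lef_pV2 ?posrE//.
  by rewrite ler_nat leqW// leq_addl.
have nV k : (n (k + k0)%N)%:R^-1 <= k0%:R^-1 :> R.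
  by rewrite lef_pV2 ?posrE ?k00 ?ltr0n//; exact: le_nat.
have k0V1 : k0%:R^-1 <= 1 :> R by rewrite invf_le1; lra.
have k0Vt : k0%:R^-1 <= t0 / 4.
  by rewrite -[t0 / 4]invrK lef_pV2 ?posrE ?invr_gt0 ?divr_gt0// ?invf_div//; lra.
pose tau k := node R (n (k + k0)%N) (idx (n (k + k0)%N) (t (k + k0)%N)).
pose X k := node R (n (k + k0)%N) (idx (n (k + k0)%N) (x (k + k0)%N)).
have shift (s : nat -> R) (l : R) : (forall k, `|s k - l| < k.+1%:R^-1) ->
    s (k + k0)%N @[k --> \oo] --> l.
  by move=> /near_seq_cvg sl; rewrite cvg_shiftn.
have tau_cvg : tau @ \oo --> t0 by apply: cvg_node_idx => //; exact: shift.
have X_cvg : X @ \oo --> x0 by apply: cvg_node_idx => //; exact: shift.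
have tk k : t0 - t0 / 4 <= t (k + k0)%N <= T.
  have := tt0 (k + k0)%N; rewrite ltr_norml => /andP[].
  have := le_trans (k1V k) k0Vt; have := le_trans (k1V k) k0V1.
  move: (_.+1%:R^-1) (t _) => u s u1 ut h1 h2.
  by rewrite /T; apply/andP; split; lra.
(* At most [t0 / 4] is lost between [t0] and [t], and as much again by rounding [t] down. *)
have tauP k : t0 / 2 <= tau k <= T.
  have := @node_idx_itv R (n (k + k0)%N) (t (k + k0)%N) (n0 k).
  have := tk k; have := le_trans (nV k) k0Vt; rewrite -/(tau k).
  move: (_%:R^-1) (t _) (tau k) => u s v ut /andP[h1 h2] /andP[h3 h4].
  by apply/andP; split; lra.
have Xk k : `|X k| <= `|x0| + 2.
  have := @node_idx_itv R (n (k + k0)%N) (x (k + k0)%N) (n0 k).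
  have := xx0 (k + k0)%N; have := le_trans (k1V k) k0V1.
  have := le_trans (nV k) k0V1; have := ler_normD (X k - x0) x0; rewrite subrK.
  rewrite -/(X k); suff : forall u v y z : R, u <= 1 -> v <= 1 ->
      `|y - x0| < v -> z <= y < z + u -> `|z - x0| <= 2.
    by move=> h h1 h2 h3 h4 h5; have := h _ _ _ _ h2 h3 h4 h5; lra.
  move=> u v y z u1 v1; rewrite ltr_norml ler_norml => /andP[h1 h2] /andP[h3 h4].
  by apply/andP; split; lra.
have approx k : normc (grid_conv (n (k + k0)%N)
    (inv_transform (n (k + k0)%N) (@cutoff R (n (k + k0)%N) (M (k + k0)%N)))
    (f (k + k0)%N) (t (k + k0)%N) (x (k + k0)%N) -
    gauss_conv (n (k + k0)%N) (m (k + k0)%N) (M (k + k0)%N) g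
    (t (k + k0)%N) (x (k + k0)%N)) < d / 3.
  have nm' := nm (k + k0)%N; have mM' := mM (k + k0)%N.
  have Mn' := Mn (k + k0)%N; have n0k := n0 k; have tauk := tauP k.
  have Xkk := Xk k; have tkk := tk k; have f_solk := f_sol (k + k0)%N.
  have t_timek := t_time (k + k0)%N.
  have kk : k0%:R <= (k + k0)%:R :> R by rewrite ler_nat leq_addl.
  have kM := le_nat k M M_ge; have km := le_nat k m m_ge.
  rewrite /tau /X in tauk Xkk.
  move: (n _) (m _) (M _) (f _) (t _) (x _) nm' mM' Mn' n0k tauk Xkk tkk f_solk
    t_timek kM km => n' m' M' f' t' x' nm' mM' Mn' n0k tauk Xkk /andP[_ tT] f_solk
    t_timek kM km.
  have n0R : 0 < n'%:R :> R by rewrite ltr0n.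
  have mM2 : m'%:R ^+ 2 <= M'%:R :> R.
    rewrite -[leRHS]sqr_sqrtr// lerXn2r ?nnegrE ?sqrtr_ge0//; exact: ltW.
  have Mn2 : expR (M'%:R ^+ 2) <= n'%:R :> R.
    have ln0 : 0 < ln n'%:R :> R.
      by rewrite -sqrtr_gt0 (le_lt_trans _ Mn').
    rewrite -[leRHS]lnK ?posrE// ler_expR -[leRHS]sqr_sqrtr ?(ltW ln0)//.
    by rewrite lerXn2r ?nnegrE ?sqrtr_ge0//; exact: ltW.
  have mn' : (m' + 2 <= n')%N.
    by rewrite -(ler_nat R) natrD; lra.
  apply: le_lt_trans (@grid_conv_gauss_conv_le R n' m' M' g f' t' x' t0 c K1
    t0_gt0 c0 c1 ct K10 gK1 _ _ Mn2 mM2 _ tauk _ mn' t_timek _ f_solk) _.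
  - by rewrite -(ler_nat R); lra.
  - by have := ler_norm (amp_cst * T); rewrite /T in kamp *; lra.
  - by rewrite -(ltr_nat R); lra.
  - apply: le_trans mM2; apply: (@le_trans _ _ (2 * m'%:R)); first by lra.
    by rewrite expr2 ler_wpM2r//; lra.
  - rewrite -(ltr_int R) intrM intrB -[(n' * (n' - m'))%N%:~R]/((n' * (n' - m'))%:R).
    rewrite natrM natrB; last by apply: leq_trans mn'; exact: leq_addr.
    have h1 : (idx n' t')%:~R <= n'%:R * t' by exact: floor_le_tmp.
    have h2 : n'%:R * t' <= n'%:R * T by rewrite ler_wpM2l// ltW.
    have n1R : 1 <= n'%:R :> R by rewrite ler1n.
    (* The support drifts left by at most [2 n T] cells, and the gap [n - m] exceeds [2 T] with room
       to spare. *)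
    have h3 : n'%:R * (2 * T + 6) <= n'%:R * (n'%:R - m'%:R).
      by rewrite ler_wpM2l ?(ltW n0R)//; lra.
    by rewrite -[2%:~R]/(2%:R); lra.
  have M0 : 0 < M'%:R :> R by lra.
  rewrite -/Cst -mulrA.
  apply: (@le_lt_trans _ _ (`|Cst| * M'%:R^-1)).
    rewrite (le_trans (ler_wpM2r _ (ler_norm Cst))) ?mulr_ge0 ?exprn_ge0 ?expR_ge0//.
    rewrite ler_wpM2l// -expRM_natl -expRD.
    apply: (@le_trans _ _ (expR (- M'%:R))).
      (* Then [7 M - c M ^ 2 <= - M], which disposes of the seventh power. *)
      rewrite ler_expR; have : 8 <= c * M'%:R.
        by rewrite mulrC -ler_pdivrMr//; exact: le_trans kM.
      by nra.
    rewrite expRN lef_pV2 ?posrE ?expR_gt0//.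
    by have := expR_ge1Dx (M'%:R : R); lra.
  rewrite ltr_pdivrMr//.
  have : 3 * `|Cst| / d < M'%:R.
    by apply: lt_le_trans kM; apply: lt_le_trans kC; rewrite ltrDl.
  by rewrite ltr_pdivrMr//; lra.
have gauss_cvg (phi : R -> R) : continuous phi ->
    (forall y, `|phi y| <= normc (g y)) ->
    gauss_sum (n (k + k0)%N) (M (k + k0)%N) (tau k) 0 *
    ((n (k + k0)%N)%:R^-1 * sym_sum (m (k + k0)%N * n (k + k0)%N) (fun l =>
      (if - (m (k + k0)%N)%:R <= node R (n (k + k0)%N) l < (m (k + k0)%N)%:R
        then phi (node R (n (k + k0)%N) l) else 0) *
      expR (- ((X k - node R (n (k + k0)%N) l) ^+ 2 / (4 * tau k)))))
    @[k --> \oo] --> (Num.sqrt (4 * pi * t0))^-1 *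
    \int[lebesgue_measure]_(y in [set: R])
      (expR (- (x0 - y) ^+ 2 / (4 * t0)) * phi y).
  move=> phi_cont phig; apply: cvgM.
    exact: (@gauss_sum0_cvg R (fun k => n (k + k0)%N) (fun k => M (k + k0)%N)).
  apply: (@heat_riemann_cvg R (fun k => n (k + k0)%N) (fun k => m (k + k0)%N)
    tau X t0 x0 n0 nk mk t0_gt0 tauP tau_cvg X_cvg phi Ka) => // y.
  exact: le_trans (gKa y).
(* One third of [d] is for the kernel error, and one each for the real and the imaginary part of the
   limit. *)
have d3 : 0 < d / 3 by rewrite divr_gt0.
have re := gauss_cvg _ (continuous_Re g_cont) (fun y => norm_Re_le (g y)).
have im := gauss_cvg _ (continuous_Im g_cont) (fun y => norm_Im_le (g y)).
move: re im; rewrite -Re_classical_heat// -Im_classical_heat//.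
move=> /cvgrPdist_lt /(_ _ d3) re /cvgrPdist_lt /(_ _ d3) im.
have [k [/= rek imk]] := filter_ex (filterI re im).
exists (k + k0)%N; rewrite -[`|_|]/((normc _)%:C) ltcR.
rewrite -[X in X - _](subrK (gauss_conv (n (k + k0)%N) (m (k + k0)%N)
  (M (k + k0)%N) g (t (k + k0)%N) (x (k + k0)%N))) -addrA.
rewrite (le_lt_trans (le_normcD _ _))//.
rewrite -Re_gauss_conv -ReB in rek; rewrite -Im_gauss_conv -ImB in imk.
have := approx k; have := normc_le (classical_heat g t0 x0 - gauss_conv
  (n (k + k0)%N) (m (k + k0)%N) (M (k + k0)%N) g (t (k + k0)%N) (x (k + k0)%N)).
by rewrite -normcN opprB; lra.
Qed.

Theorem theorem0p17 (N : nonstandard_universe) (R : realType)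
  (g : R -> R[i]) (A B rho : R)
  (g_cont : continuous (g : R -> R[i]^o))
  (g_bound : forall x : R, `|g x| <= (A * expR (B * `|x| `^ rho))%:C)
  (rho_lt2 : rho < 2)
  (eta omega omega' : star N nat)
  (eta_inf : infinite_snat eta)
  (omega_inf : infinite_snat omega)
  (omega'_inf : infinite_snat omega')
  (eta_omega : positive_infinite (ssub (snat R eta) (snat R omega)))
  (omega_omega' : slt (snat R omega) (smap Num.sqrt (snat R omega')))
  (omega'_eta : slt (snat R omega')
                  (smap Num.sqrt (smap (@ln R) (snat R eta))))
  (f : star N (R -> R -> R[i]))
  (f_sol : heat_solution eta (struncate omega (smeas_ext eta g)) f)
  (t x : star N R) :
  smem t (stime R eta) -> star_finite t -> 0 < st t ->
  smem x (sspace R eta) -> star_finite x ->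
  let z := sapp2 (sconv eta (sinv_transform eta (scutoff R eta omega')) f) t x in
  star_finite z /\ st z = classical_heat g (st t) (st x).
Proof.
move=> t_time t_fin t_gt0 _ x_fin z.
(* Having a standard part at all implies finiteness, so both conclusions reduce to this. *)
suff z_st : is_std_part z (classical_heat g (st t) (st x)).
  split; last exact: st_eq.
  exists (1 + `|classical_heat g (st t) (st x)|).
  apply: sub_sholds (z_st 1 ltr01) => y /ltW y1.
  by rewrite -[y in `|y|](subrK (classical_heat g (st t) (st x)))
    (le_trans (ler_normD _ _))// lerD2r.
have t_st := st_is_std_part t_fin; have x_st := st_is_std_part x_fin.
(* All internal data are components of one point [c], which turns every internal
   statement into [sholds] of a standard predicate at [c]. *)
pose W := (nat * nat * nat * (R -> R -> R[i]) * R * R)%type.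
pose wn (w : W) := w.1.1.1.1.1; pose wm (w : W) := w.1.1.1.1.2.
pose wM (w : W) := w.1.1.1.2; pose wf (w : W) := w.1.1.2.
pose wt (w : W) := w.1.2; pose wx (w : W) := w.2.
pose c : star N W :=
  spair (spair (spair (spair (spair eta omega) omega') f) t) x.
have xE : x = smap wx c by rewrite smap_snd.
have tE : t = smap wt c by rewrite /wt (smap_comp fst snd) smap_fst smap_snd.
have fE : f = smap wf c.
  rewrite /wf (smap_comp fst (fun y => y.1.2)) smap_fst.
  by rewrite (smap_comp fst snd) smap_fst smap_snd.
have ME : omega' = smap wM c.
  rewrite /wM (smap_comp fst (fun y => y.1.1.2)) smap_fst.
  rewrite (smap_comp fst (fun y => y.1.2)) smap_fst.
  by rewrite (smap_comp fst snd) smap_fst smap_snd.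
have mE : omega = smap wm c.
  rewrite /wm (smap_comp fst (fun y => y.1.1.1.2)) smap_fst.
  rewrite (smap_comp fst (fun y => y.1.1.2)) smap_fst.
  rewrite (smap_comp fst (fun y => y.1.2)) smap_fst.
  by rewrite (smap_comp fst snd) smap_fst smap_snd.
have nE : eta = smap wn c.
  rewrite /wn (smap_comp fst (fun y => y.1.1.1.1)) smap_fst.
  rewrite (smap_comp fst (fun y => y.1.1.1)) smap_fst.
  rewrite (smap_comp fst (fun y => y.1.1)) smap_fst.
  by rewrite (smap_comp fst fst) smap_fst smap_fst.
move: (infinite_snat_ge ^~ eta_inf) (infinite_snat_ge ^~ omega_inf).
move: (infinite_snat_ge ^~ omega'_inf) f_sol t_time.
move: eta_omega omega_omega' omega'_eta t_st x_st.
rewrite /z /is_std_part; move: (st t) (st x) t_gt0 => t0 x0 t_gt0.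
rewrite xE tE fE ME mE nE /snat /stime /sspace -!smap_comp.
rewrite /positive_infinite /slt /sholds2 /ssub !smap2_smap.
rewrite /struncate /smeas_ext -(smap_cst g c) !smap2_smap.
rewrite /sconv /sinv_transform /scutoff !(spair_smap, smap2_smap) sapp2_smap.
move=> nm; rewrite -!sholds_map => mM Mn tt0 xx0 M_ge.
move=> /heat_solution_smap f_sol /smem_smap t_time.
move=> n_ge m_ge e e0.
rewrite -sholds_map; apply: contrapT => /sholds_not far.
(* For each [k] these are finitely many conditions, all holding at [c], so their conjunction has a
   standard instance. The radius uses [k.+1] to be positive at [k = 0] too. *)
have wP k : exists w : W, [/\ (k <= wn w)%N, (k <= wm w)%N & (k <= wM w)%N] /\
  [/\ k%:R < (wn w)%:R - (wm w)%:R :> R,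
    (wm w)%:R < Num.sqrt (wM w)%:R :> R &
    (wM w)%:R < Num.sqrt (ln (wn w)%:R) :> R] /\
  [/\ discrete_heat_solution (wn w) (truncate (wm w) (meas_ext (wn w) g)) (wf w)
   & grid_time (wn w) (wt w)] /\
  [/\ `|wt w - t0| < k.+1%:R^-1, `|wx w - x0| < k.+1%:R^-1 &
    ~ `|grid_conv (wn w) (inv_transform (wn w) (@cutoff R (wn w) (wM w))) (wf w)
        (wt w) (wx w) - classical_heat g t0 x0| < e].
  have k0 : 0 < k.+1%:R^-1 :> R by rewrite invr_gt0.
  have nmk := nm k%:R.
  rewrite -(smap_cst k%:R c) spair_smap -sholds_map in nmk.
  move: (n_ge k) (m_ge k) (M_ge k) (tt0 _ k0) (xx0 _ k0).
  rewrite -!sholds_map => nk mk Mk tk xk.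
  have /(sholds_conj (sholds_conj nk (sholds_conj mk Mk))) :=
    sholds_conj (sholds_conj nmk (sholds_conj mM Mn))
     (sholds_conj (sholds_conj f_sol t_time)
       (sholds_conj tk (sholds_conj xk far))).
  move=> /sholds_inhabited[w [[? [? ?]] [[? [? ?]] [[? ?] [? [? ?]]]]]].
  by exists w; split; [split|split; [split|split; split]].
have [w wwP] := choice wP.
have [k] := @heat_limit R g A B rho g_cont g_bound rho_lt2 (wn \o w) (wm \o w)
    (wM \o w) (wf \o w) (wt \o w) (wx \o w) t0 x0 t_gt0
    (fun k => let: conj (And3 a b c) _ := wwP k in a)
    (fun k => let: conj (And3 a b c) _ := wwP k in b)
    (fun k => let: conj (And3 a b c) _ := wwP k in c)
    (fun k => let: conj _ (conj (And3 a b c) _) := wwP k in a)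
    (fun k => let: conj _ (conj (And3 a b c) _) := wwP k in b)
    (fun k => let: conj _ (conj (And3 a b c) _) := wwP k in c)
    (fun k => let: conj _ (conj _ (conj (conj a b) _)) := wwP k in a)
    (fun k => let: conj _ (conj _ (conj (conj a b) _)) := wwP k in b)
    (fun k => let: conj _ (conj _ (conj _ (And3 a b c))) := wwP k in a)
    (fun k => let: conj _ (conj _ (conj _ (And3 a b c))) := wwP k in b) e e0.
by case: (wwP k) => _ [_ [_ [_ _]]].
Qed.
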